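(* A nondecreasing function $\theta:(0,\infty)\to[0,\infty)$ satisfies $\theta\le\omega_f$ for some Lipschitz function $f:\mathbb{H}\to L_2$ if and only if $$\int_1^\infty\left(\frac{\theta(t)}{t}\right)^2\frac{dt}{t}<\infty.$$
   Context: $\mathbb{H}=\langle a,b \mid aba^{-1}b^{-1}\text{ is central}\rangle$ is the discrete Heisenberg group, and $d_W$ is the left-invariant word metric on $\mathbb{H}$ associated to the symmetric generating set $S=\{a,b,a^{-1},b^{-1}\}$; ''Lipschitz'' is with respect to $d_W$. $L_2$ is Hilbert space with norm $\|\cdot\|_2$. For a Lipschitz function $f:\mathbb{H}\to L_2$, the compression rate $\omega_f$ is the largest function $\omega_f:(0,\infty)\to[0,\infty)$ such that $\|f(x)-f(y)\|_2\ge\omega_f(d_W(x,y))$ for all $x,y\in\mathbb{H}$. Thus $\theta\le\omega_f$ means that $\|f(x)-f(y)\|_2\ge\theta(d_W(x,y))$ for all distinct $x,y\in\mathbb{H}$. *)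

(* Defs.v *)
From HB Require Import structures.
From mathcomp Require Import all_boot all_order all_algebra.
From mathcomp Require Import generic_quotient.
From mathcomp Require Import all_classical all_reals all_analysis.

Set Implicit Arguments.
Unset Strict Implicit.
Unset Printing Implicit Defensive.
Import Order.TTheory GRing.Theory Num.Theory.
Import numFieldNormedType.Exports.

Local Open Scope classical_set_scope.
Local Open Scope group_scope.

(* The letter (t, false) stands for the generator t, (t, true) for t^-1. *)
Definition word (T : Type) := seq (T * bool).

Definition letter_inv (T : Type) (l : T * bool) : T * bool := (l.1, ~~ l.2).

Definition word_inv (T : Type) (w : word T) : word T :=
  rev (map (@letter_inv T) w).

Inductive word_congr (T : Type) (rels : set (word T)) :
    word T -> word T -> Prop :=
| word_congr_refl w : word_congr rels w w
| word_congr_sym u v : word_congr rels u v -> word_congr rels v u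
| word_congr_trans u v w :
    word_congr rels u v -> word_congr rels v w -> word_congr rels u w
| word_congr_cat u u' v v' : word_congr rels u u' -> word_congr rels v v' ->
    word_congr rels (u ++ v) (u' ++ v')
| word_congr_cancel l : word_congr rels [:: l; letter_inv l] [::]
| word_congr_relator w : rels w -> word_congr rels w [::].

Section PresentedGroup.
Variables (T : choiceType) (rels : set (word T)).

Definition word_congrb (u v : word T) : bool := `[< word_congr rels u v >].

Lemma word_congrb_refl : reflexive word_congrb.
Proof. by move=> w; apply/asboolP; exact: word_congr_refl. Qed.

Lemma word_congrb_sym : symmetric word_congrb.
Proof.
by move=> u v; apply/asboolP/asboolP => uv; exact: word_congr_sym uv.
Qed.

Lemma word_congrb_trans : transitive word_congrb.
Proof.
move=> v u w /asboolP uv /asboolP vw; apply/asboolP.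
exact: word_congr_trans uv vw.
Qed.

Canonical word_congrb_equiv :=
  EquivRel word_congrb word_congrb_refl word_congrb_sym word_congrb_trans.

(* The group with generators T and relators rels. *)
Definition presented : Type := {eq_quot word_congrb}%qT.
HB.instance Definition _ := Choice.on presented.
HB.instance Definition _ := EqQuotient.on presented.

Definition word_class (w : word T) : presented := (\pi_presented w)%qT.

Lemma word_classP u v : word_class u = word_class v <-> word_congr rels u v.
Proof.
have E : reflect (word_class u = word_class v) (word_congrb u v).
  exact: (@eqmodP _ word_congrb_equiv u v).
by split=> [/E/asboolP|uv] //; apply/E/asboolP.
Qed.

Lemma word_class_repr (x : presented) : word_class (repr x) = x.
Proof. exact: reprK. Qed.

Lemma word_congr_repr w : word_congr rels (repr (word_class w)) w.
Proof. by apply/word_classP; rewrite word_class_repr. Qed.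

Lemma word_invK : involutive (@word_inv T).
Proof.
move=> w; rewrite /word_inv map_rev revK -map_comp map_id_in // => -[t c] _ /=.
by rewrite /letter_inv /= negbK.
Qed.

Lemma word_congr_mulwV w : word_congr rels (w ++ word_inv w) [::].
Proof.
elim: w => [|l w IHw]; first exact: word_congr_refl.
have -> : (l :: w) ++ word_inv (l :: w) =
          [:: l] ++ ((w ++ word_inv w) ++ [:: letter_inv l]).
  by rewrite /word_inv /= rev_cons -cats1 -catA.
apply: word_congr_trans (word_congr_cancel rels l).
rewrite -[X in word_congr _ _ X]/([:: l] ++ ([::] ++ [:: letter_inv l])).
apply: word_congr_cat; first exact: word_congr_refl.
by apply: word_congr_cat IHw (word_congr_refl _ _).
Qed.

Lemma word_congr_mulVw w : word_congr rels (word_inv w ++ w) [::].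
Proof. by have := word_congr_mulwV (word_inv w); rewrite word_invK. Qed.

Lemma word_congr_inv u v :
  word_congr rels u v -> word_congr rels (word_inv u) (word_inv v).
Proof.
move=> uv; apply: (@word_congr_trans _ _ _ (word_inv u ++ (v ++ word_inv v))).
  rewrite -[X in word_congr _ X _]cats0.
  apply: word_congr_cat; first exact: word_congr_refl.
  exact: word_congr_sym (word_congr_mulwV v).
rewrite catA -[X in word_congr _ _ X]cat0s.
apply: word_congr_cat; last exact: word_congr_refl.
apply: word_congr_trans (word_congr_mulVw u).
by apply: word_congr_cat (word_congr_refl _ _) (word_congr_sym uv).
Qed.

Let one : presented := word_class [::].
Let mul (x y : presented) : presented := word_class (repr x ++ repr y).
Let inv (x : presented) : presented := word_class (word_inv (repr x)).

Let mulE u v : mul (word_class u) (word_class v) = word_class (u ++ v).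
Proof.
by apply/word_classP; apply: word_congr_cat; exact: word_congr_repr.
Qed.

Let invE u : inv (word_class u) = word_class (word_inv u).
Proof. by apply/word_classP; apply: word_congr_inv; exact: word_congr_repr. Qed.

Let mulA : associative mul.
Proof.
move=> x y z; rewrite -[x]word_class_repr -[y]word_class_repr.
by rewrite -[z]word_class_repr !mulE catA.
Qed.

Let mul1 : left_id one mul.
Proof. by move=> x; rewrite -[x]word_class_repr mulE. Qed.

Let mulr1 : right_id one mul.
Proof. by move=> x; rewrite -[x]word_class_repr mulE cats0. Qed.

Let mulV : left_inverse one inv mul.
Proof.
move=> x; rewrite -[x]word_class_repr invE mulE.
by apply/word_classP; exact: word_congr_mulVw.
Qed.

Let mulrV : right_inverse one inv mul.
Proof.
move=> x; rewrite -[x]word_class_repr invE mulE.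
by apply/word_classP; exact: word_congr_mulwV.
Qed.

HB.instance Definition _ := isGroup.Build presented mulA mul1 mulr1 mulV mulrV.

Lemma word_class0 : word_class [::] = 1.
Proof. by []. Qed.

Lemma word_class_cat u v : word_class (u ++ v) = word_class u * word_class v.
Proof. by rewrite -mulE. Qed.

Lemma word_class_inv u : word_class (word_inv u) = (word_class u)^-1.
Proof. by rewrite -invE. Qed.

End PresentedGroup.

(* Generators: false is a, true is b.  The relators express that the element
   a b a^-1 b^-1 commutes with every word. *)
Definition heis_commutator : word bool :=
  [:: (false, false); (true, false); (false, true); (true, true)].

Definition heis_relators : set (word bool) :=
  [set w | exists u : word bool, w = heis_commutator ++ u ++
     word_inv heis_commutator ++ word_inv u].

Definition heisenberg : groupType := presented heis_relators.

Definition heis_a : heisenberg := word_class heis_relators [:: (false, false)].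
Definition heis_b : heisenberg := word_class heis_relators [:: (true, false)].

Definition heis_S : set heisenberg :=
  [set heis_a; heis_b; heis_a^-1; heis_b^-1].

Definition is_product (G : groupType) (S : set G) (n : nat) (x : G) : Prop :=
  exists s : seq G,
    [/\ size s = n, {in s, forall g, S g} & x = \prod_(g <- s) g].

(* The default value 0 is used only when x is not a product of elements
   of S, which cannot happen for heis_S, see heis_word_lengthP. *)
Definition word_length (G : groupType) (S : set G) (x : G) : nat :=
  xget 0%N [set n | is_product S n x /\
                    forall m, is_product S m x -> (n <= m)%N].

Definition word_dist (G : groupType) (S : set G) (x y : G) : nat :=
  word_length S (x^-1 * y).

Definition heis_dW : heisenberg -> heisenberg -> nat := word_dist heis_S.

Lemma heis_commutator_central (x : heisenberg) :
  commute (heis_a * heis_b * heis_a^-1 * heis_b^-1) x.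
Proof.
have -> : heis_a * heis_b * heis_a^-1 * heis_b^-1 =
          word_class heis_relators heis_commutator.
  rewrite -[heis_commutator]/([:: (false, false)] ++ [:: (true, false)] ++
    word_inv [:: (false, false)] ++ word_inv [:: (true, false)]).
  by rewrite !word_class_cat !word_class_inv !mulgA.
rewrite -[x]word_class_repr; set c := word_class _ _; set u := repr x.
have : word_class heis_relators (heis_commutator ++ u ++
     word_inv heis_commutator ++ word_inv u) = 1.
  rewrite -word_class0; apply/word_classP/word_congr_relator.
  by exists u.
rewrite !word_class_cat !word_class_inv -/c mulgA => /(canRL (mulgK _)).
by rewrite mul1g invgM !invgK.
Qed.

Lemma heis_word_lengthP (x : heisenberg) :
  is_product heis_S (word_length heis_S x) x /\
  forall m, is_product heis_S m x -> (word_length heis_S x <= m)%N.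
Proof.
have prod_word (w : word bool) :
    exists n, is_product heis_S n (word_class heis_relators w).
  elim: w => [|l w [n [s [sn sS ws]]]].
    by exists 0%N, [::]; split => //; rewrite big_nil.
  exists n.+1, (word_class heis_relators [:: l] :: s); split => /=.
  - by rewrite sn.
  - move=> g; rewrite inE => /orP[/eqP ->|/sS//].
    case: l => -[] [].
    + by right; rewrite -[heis_b^-1]word_class_inv.
    + by left; left; right.
    + by left; right; rewrite -[heis_a^-1]word_class_inv.
    + by left; left; left.
  - by rewrite big_cons -ws -word_class_cat.
have exP : exists n, `[< is_product heis_S n x >].
  have [n nx] := prod_word (repr x); exists n; apply/asboolP.
  by rewrite -[x]word_class_repr.
rewrite /word_length; case: xgetP => [n _ []//|nomin].
case: (ex_minnP exP) => n /asboolP nx nmin.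
case: (nomin n); split=> // m mx; apply: nmin; exact/asboolP.
Qed.

Local Close Scope group_scope.
Local Open Scope ring_scope.

(* The Hilbert space L_2 is realized as L_2(R), real-valued functions on the
   line modulo equality almost everywhere for Lebesgue measure. *)
Definition L2 (R : realType) : Type := LspaceType2 (@lebesgue_measure R).

(* The norm of u - v: the Lnorm does not depend on representatives. *)
Definition L2dist (R : realType) (u v : L2 R) : R :=
  fine ('N[@lebesgue_measure R]_(2%:E)[EFin \o ((u : R -> R) \- (v : R -> R))]).

Definition heis_lipschitz (R : realType) (f : heisenberg -> L2 R) : Prop :=
  exists L : R, forall x y, L2dist (f x) (f y) <= L * (heis_dW x y)%:R.

Definition compression_bound (R : realType) (f : heisenberg -> L2 R)
    (w : R -> R) : Prop :=
  (forall t, 0 < t -> 0 <= w t) /\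
  (forall x y, x != y -> w (heis_dW x y)%:R <= L2dist (f x) (f y)).

(* The largest function w : (0, oo) -> [0, oo) with
   ||f x - f y|| >= w (d_W (x, y)).  It is +oo at those t which are not
   distances in the group, where w is unconstrained. *)
Definition compression_rate (R : realType) (f : heisenberg -> L2 R) (t : R) :
    \bar R :=
  ereal_sup [set (w t)%:E | w in [set w | compression_bound f w]].

Lemma heis_dW_gt0 (x y : heisenberg) : x != y -> (0 < heis_dW x y)%N.
Proof.
move=> xy; rewrite lt0n; apply: contra xy => /eqP d0.
have [[s [+ _ xys]] _] := heis_word_lengthP (x^-1 * y)%g.
rewrite -/(word_dist _ _ _) -/(heis_dW x y) d0 => /size0nil s0.
move: xys; rewrite s0 big_nil => /(canRL (mulKg _)).
by rewrite invgK mulg1 => ->.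
Qed.

Lemma le_compression_rateP (R : realType) (f : heisenberg -> L2 R)
    (theta : R -> R) : (forall t, 0 < t -> 0 <= theta t) ->
  (forall t, 0 < t -> ((theta t)%:E <= compression_rate f t)%E) <->
  (forall x y, x != y -> theta (heis_dW x y)%:R <= L2dist (f x) (f y)).
Proof.
move=> theta0; split=> [le_theta x y xy|le_theta t t0].
  rewrite -lee_fin (le_trans (le_theta _ _)) ?ltr0n ?heis_dW_gt0//.
  by apply: ge_ereal_sup => _ [w [_ wb] <-]; rewrite lee_fin wb.
by apply: ereal_sup_ubound; exists theta.
Qed.

(* Main.v *)
Require Import Defs.
From HB Require Import structures.
From mathcomp Require Import all_boot all_order all_algebra.
From mathcomp Require Import generic_quotient separable cyclic cyclotomic complex.
From mathcomp Require Import all_classical all_reals all_analysis.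
From mathcomp Require Import measurable_realfun.
From mathcomp Require Import zify ring lra.
Import Order.TTheory GRing.Theory Num.Theory.
Import numFieldNormedType.Exports.
Local Open Scope classical_set_scope.
Local Open Scope ring_scope.

(** Elements of the group are written b^y a^x c^z with c = [a, b] central, which
    identifies it with Z^3 for the product (x, y, z) (x', y', z') =
    (x + x', y + y', z + z' + x y').  As c^(q m) = [a^q, b^m], the ball of radius m
    is comparable to the box |x|, |y| <= m, |z| <= m^2 ([coord_le_length],
    [word_length_box]); in particular c^(4^j) lies at distance about 2^j.  Because
    theta is monotone, finiteness of the integral amounts to boundedness of the sums
    of theta(2^j)^2 / 4^j over j < J ([dyadic_sum_of_integral],
    [integral_of_dyadic_sum]).

    Necessity.  In a unitary representation where c acts as the scalar z, the vector
    (a b - b a) u is (1 - 1/z) a b u.  Pairing it with a b u and moving one difference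
    to the other side of each inner product gives
    |1 - z| |u|^2 <= 6 (|a u - u|^2 + |b u - u|^2) ([single_frequency]): this is the
    uncertainty principle, with the frequency to the first power only.  On the other
    side, the sum over j of 4^-j |z^(4^j) - 1|^2 is O(|1 - z|)
    ([sum_sqmod_expX4_sub1]).  Decomposing along the characters of the centre of a
    finite quotient, one gets for every function v that the sum over j of
    4^-j |c^(4^j) v - v|^2 is O(|a v - v|^2 + |b v - v|^2) ([vertical_horizontal]).
    Apply this to f - f(1) multiplied by a cutoff adapted to the box of size
    n = 2^J.  The cutoff has gradient O(1 / n) and |f - f(1)| = O(L n) on the box, so
    the right-hand side is O(L^2) per point, while the left-hand side is at least the
    sum of theta(2^j)^2 / 4^j per point of a smaller box ([theta_sum_le]).

    Sufficiency.  The right regular orbit maps g |-> phi(. g) - phi of finitely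
    supported functions phi are added up over the scales 2^k, phi being the cutoff of
    the box of size 2^k multiplied by theta(2^(k+7)) / 4^k.  A box of size n has
    about n^4 points, so a generator moves the k-th summand by a multiple of
    theta(2^(k+7)) / 2^k, whose squares are summable ([energy_gen]); and an element
    of length between 2^(k+6) and 2^(k+7) makes the supports disjoint, so that it
    moves the k-th summand by at least theta(2^(k+7)) ([energy_lower]).  The sum is
    realised in the Hilbert space of square-integrable functions on the line by step
    functions ([L2_of_family]). *)

Set Implicit Arguments.
Unset Strict Implicit.
Unset Printing Implicit Defensive.

(** * The Heisenberg group in coordinates *)

Definition heisZ : Type := (int * int * int)%type.
HB.instance Definition _ := Choice.on heisZ.
HB.instance Definition _ := Countable.on heisZ.

(** The multiplication rule of the words b^y a^x c^z when c is central and
    a b = b a c. *)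
Definition heisZ_mul (p q : heisZ) : heisZ :=
  (p.1.1 + q.1.1, p.1.2 + q.1.2, p.2 + q.2 + p.1.1 * q.1.2).
Definition heisZ_inv (p : heisZ) : heisZ :=
  (- p.1.1, - p.1.2, p.1.1 * p.1.2 - p.2).

(** Triples of integers carry other canonical structures; this constructor pins down
    the noncommutative one. *)
Definition mkZ (x y z : int) : heisZ := (x, y, z).

Lemma mkZP (P : heisZ -> Prop) : (forall x y z, P (mkZ x y z)) -> forall p, P p.
Proof. by move=> PZ [[x y] z]; exact: PZ. Qed.

Lemma mkZ_eq (x y z x' y' z' : int) : x = x' -> y = y' -> z = z' ->
  mkZ x y z = mkZ x' y' z'.
Proof. by move=> -> -> ->. Qed.

Lemma heisZ_mulA : associative heisZ_mul.
Proof.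
by do 3 elim/mkZP => ? ? ?; apply: mkZ_eq => /=; ring.
Qed.

Lemma heisZ_mul1 : left_id (0, 0, 0) heisZ_mul.
Proof. by elim/mkZP => ? ? ?; apply: mkZ_eq => /=; ring. Qed.

Lemma heisZ_mulr1 : right_id (0, 0, 0) heisZ_mul.
Proof. by elim/mkZP => ? ? ?; apply: mkZ_eq => /=; ring. Qed.

Lemma heisZ_mulV : left_inverse (0, 0, 0) heisZ_inv heisZ_mul.
Proof. by elim/mkZP => ? ? ?; apply: mkZ_eq => /=; ring. Qed.

Lemma heisZ_mulrV : right_inverse (0, 0, 0) heisZ_inv heisZ_mul.
Proof. by elim/mkZP => ? ? ?; apply: mkZ_eq => /=; ring. Qed.

HB.instance Definition _ :=
  isGroup.Build heisZ heisZ_mulA heisZ_mul1 heisZ_mulr1 heisZ_mulV heisZ_mulrV.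

Lemma heisZME (x y z x' y' z' : int) :
  (mkZ x y z * mkZ x' y' z')%g = mkZ (x + x') (y + y') (z + z' + x * y').
Proof. by []. Qed.

Lemma heisZVE (x y z : int) : (mkZ x y z)^-1%g = mkZ (- x) (- y) (x * y - z).
Proof. by []. Qed.

Lemma heisZ1E : 1%g = mkZ 0 0 0.
Proof. by []. Qed.

Section Coordinates.
Local Open Scope group_scope.

Definition letter_coord (l : bool * bool) : heisZ :=
  let g : heisZ := if l.1 then (mkZ 0 1 0) else (mkZ 1 0 0) in
  if l.2 then g^-1 else g.

Definition word_coord (w : word bool) : heisZ :=
  \prod_(l <- w) letter_coord l.

Lemma letter_coordV l : letter_coord (letter_inv l) = (letter_coord l)^-1.
Proof. by case: l => t []; rewrite /letter_coord //= invgK. Qed.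

Lemma word_coord_cat u v : word_coord (u ++ v) = word_coord u * word_coord v.
Proof. by rewrite /word_coord big_cat. Qed.

Lemma word_coord_inv u : word_coord (word_inv u) = (word_coord u)^-1.
Proof.
elim: u => [|l u IHu]; first by rewrite /word_coord !big_nil invg1.
rewrite /word_inv /= rev_cons -cats1 word_coord_cat -/(word_inv u) IHu.
by rewrite /word_coord big_seq1 big_cons letter_coordV invgM.
Qed.

Lemma word_coord_commutator : word_coord heis_commutator = (mkZ 0 0 1).
Proof. by rewrite /word_coord unlock. Qed.

Lemma word_coord_congr u v : word_congr heis_relators u v ->
  word_coord u = word_coord v.
Proof.
elim=> {u v} //.
- by move=> u v w _ -> _ ->.
- by move=> u u' v v' _ Eu _ Ev; rewrite !word_coord_cat Eu Ev.
- move=> l; rewrite -[[:: l; _]]/([:: l] ++ [:: letter_inv l]).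
  by rewrite word_coord_cat /word_coord !big_seq1 letter_coordV mulgV big_nil.
- move=> w [u ->]; rewrite !word_coord_cat !word_coord_inv.
  rewrite word_coord_commutator /word_coord big_nil.
  elim/mkZP: (\prod_(l <- u) _) => x y z.
  by rewrite !heisZVE !heisZME; apply: mkZ_eq; ring.
Qed.

Definition heis_coord (g : heisenberg) : heisZ := word_coord (repr g).

Lemma heis_coord_word w : heis_coord (word_class heis_relators w) = word_coord w.
Proof. by apply: word_coord_congr; apply: word_congr_repr. Qed.

Lemma heis_coordM g h : heis_coord (g * h) = heis_coord g * heis_coord h.
Proof.
rewrite -[g in LHS]word_class_repr -[h in LHS]word_class_repr -word_class_cat.
by rewrite heis_coord_word word_coord_cat.
Qed.

Lemma heis_coordV g : heis_coord g^-1 = (heis_coord g)^-1.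
Proof.
by rewrite -[g in LHS]word_class_repr -word_class_inv heis_coord_word
  word_coord_inv.
Qed.

Lemma heis_coord1 : heis_coord 1 = 1.
Proof. by rewrite -word_class0 heis_coord_word /word_coord big_nil. Qed.

Lemma heis_coord_a : heis_coord heis_a = (mkZ 1 0 0).
Proof. by rewrite heis_coord_word /word_coord big_seq1. Qed.

Lemma heis_coord_b : heis_coord heis_b = (mkZ 0 1 0).
Proof. by rewrite heis_coord_word /word_coord big_seq1. Qed.

Definition zpow (G : groupType) (g : G) (n : int) : G :=
  match n with Posz k => g ^+ k | Negz k => g ^- k.+1 end.

Lemma zpowS (G : groupType) (g : G) n : zpow g (n + 1)%R = zpow g n * g.
Proof.
case: n => [n|[|n]]; last 1 first.
- have -> : (Negz n.+1 + 1 = Negz n)%R by lia.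
  by rewrite /= (expgS g n.+1) invgM mulgVK.
- have -> : (n%:Z + 1 = n.+1%:Z)%R by lia.
  by rewrite /= expgSr.
- by rewrite /= expg1 mulVg.
Qed.

Lemma int_step_ind (P : int -> Prop) : P 0%R ->
  (forall n, P n <-> P (n + 1)%R) -> forall n, P n.
Proof.
move=> P0 PS; have Pn (n : nat) : P n.
  elim: n => [|n /PS]//.
  by have -> : (n%:Z + 1 = n.+1%:Z)%R by lia.
case=> [//|]; elim=> [|n IHn]; apply/PS.
  by have -> : (Negz 0 + 1 = 0)%R by lia.
by have -> : (Negz n.+1 + 1 = Negz n)%R by lia.
Qed.

Definition heis_c : heisenberg := heis_a * heis_b * heis_a^-1 * heis_b^-1.

Lemma zpow_commute (G : groupType) (g h : G) n : commute g h -> commute (zpow g n) h.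
Proof.
move=> gh; have cX k : commute (g ^+ k) h by apply/commute_sym/commuteX/commute_sym.
case: n => n /=; first exact: cX.
by apply/commute_sym/commuteV/commute_sym/cX.
Qed.

Definition heis_of (p : heisZ) : heisenberg :=
  zpow heis_b p.1.2 * zpow heis_a p.1.1 * zpow heis_c p.2.

Lemma heis_cC g : commute heis_c g.
Proof. exact: heis_commutator_central. Qed.

Lemma heis_ab : heis_a * heis_b = heis_b * heis_a * heis_c.
Proof. by rewrite -[RHS]heis_cC /heis_c !mulgA !mulgVK. Qed.

Lemma zpow_ab x : zpow heis_a x * heis_b = heis_b * zpow heis_a x * zpow heis_c x.
Proof.
elim/int_step_ind: x => [|x]; first by rewrite !mulg1 mul1g.
have E : zpow heis_a (x + 1)%R * heis_b = zpow heis_a x * heis_b * (heis_a * heis_c).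
  by rewrite zpowS -mulgA heis_ab !mulgA.
have F : heis_b * zpow heis_a (x + 1)%R * zpow heis_c (x + 1)%R =
    heis_b * zpow heis_a x * zpow heis_c x * (heis_a * heis_c).
  rewrite !zpowS -!mulgA; do 2 congr (_ * _).
  by rewrite [RHS]mulgA (zpow_commute x (heis_cC heis_a)) -[RHS]mulgA.
by rewrite E F; split=> [->//|/mulIg].
Qed.

Lemma zpowD (G : groupType) (g : G) m n : zpow g (m + n)%R = zpow g m * zpow g n.
Proof.
elim/int_step_ind: n => [|n]; first by rewrite addr0 mulg1.
by rewrite addrA !zpowS mulgA; split=> [->//|/mulIg].
Qed.

Lemma heis_of_mula p : heis_of p * heis_a = heis_of (p * (mkZ 1 0 0)).
Proof.
have move_left (B A C g : heisenberg) : commute C g ->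
    B * A * C * g = B * (A * g) * C.
  by move=> cg; rewrite -!mulgA cg.
elim/mkZP: p => x y z; rewrite heisZME /heis_of /=.
rewrite move_left; last exact/zpow_commute/heis_cC.
by rewrite !addr0 mulr0 addr0 zpowS.
Qed.

Lemma heis_of_mulb p : heis_of p * heis_b = heis_of (p * (mkZ 0 1 0)).
Proof.
have move_left (B A C D g : heisenberg) : commute C g -> A * g = g * A * D ->
    commute D C -> B * A * C * g = B * g * A * (C * D).
  by move=> cg Ag DC; rewrite -!mulgA cg (mulgA A) Ag -DC -!mulgA.
elim/mkZP: p => x y z; rewrite heisZME /heis_of /=.
rewrite (move_left _ _ _ (zpow heis_c x)).
- by rewrite !addr0 mulr1 zpowS zpowD.
- exact/zpow_commute/heis_cC.
- exact: zpow_ab.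
- exact/zpow_commute/heis_cC.
Qed.

Lemma heis_of_mulVa p : heis_of p * heis_a^-1 = heis_of (p * (mkZ (-1) 0 0)).
Proof.
apply: (mulIg heis_a); rewrite mulgVK heis_of_mula -mulgA.
by rewrite heisZME [X in heis_of (_ * X)](_ : _ = 1) ?mulg1//; apply: mkZ_eq.
Qed.

Lemma heis_of_mulVb p : heis_of p * heis_b^-1 = heis_of (p * (mkZ 0 (-1) 0)).
Proof.
apply: (mulIg heis_b); rewrite mulgVK heis_of_mulb -mulgA.
by rewrite heisZME [X in heis_of (_ * X)](_ : _ = 1) ?mulg1//; apply: mkZ_eq.
Qed.

(** Right multiplication by a generator or its inverse acts on the normal forms
    [heis_of p] as it does on coordinates, so every word is equal to its normal
    form. *)
Lemma heis_coordK : cancel heis_coord heis_of.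
Proof.
have key w p : heis_of (p * word_coord w) = heis_of p * word_class heis_relators w.
  elim: w p => [|l w IHw] p.
    by rewrite /word_coord big_nil mulg1 word_class0 mulg1.
  rewrite -cat1s word_coord_cat word_class_cat !mulgA IHw; congr (_ * _).
  rewrite {1}/word_coord big_seq1; case: l => [[] []].
  - rewrite -[word_class _ _]/(word_class _ (word_inv [:: (true, false)])).
    by rewrite word_class_inv heis_of_mulVb.
  - by rewrite -heis_of_mulb.
  - rewrite -[word_class _ _]/(word_class _ (word_inv [:: (false, false)])).
    by rewrite word_class_inv heis_of_mulVa.
  - by rewrite -heis_of_mula.
move=> g; rewrite -[RHS]word_class_repr -[RHS]mul1g.
by rewrite -[X in X * _](_ : heis_of 1 = 1) -?key ?mul1g // /heis_of /= !mulg1.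
Qed.

Lemma heis_coordX g n : heis_coord (g ^+ n) = heis_coord g ^+ n.
Proof.
by elim: n => [|n IHn]; rewrite ?heis_coord1 // !expgS heis_coordM IHn.
Qed.

Lemma heis_coord_zpow g n : heis_coord (zpow g n) = zpow (heis_coord g) n.
Proof. by case: n => n /=; rewrite ?heis_coordV heis_coordX. Qed.

Lemma heis_ofK : cancel heis_of heis_coord.
Proof.
elim/mkZP => x y z; rewrite /heis_of !heis_coordM !heis_coord_zpow /=.
rewrite /heis_c !heis_coordM !heis_coordV heis_coord_a heis_coord_b.
have -> : zpow (mkZ 0 1 0) y = (mkZ 0 y 0).
  elim/int_step_ind: y => // y; rewrite zpowS.
  split=> [->|]; first by rewrite heisZME; apply: mkZ_eq; ring.
  move/(canRL (mulgK _)) ->; rewrite heisZVE heisZME; apply: mkZ_eq; ring.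
have -> : zpow (mkZ 1 0 0) x = (mkZ x 0 0).
  elim/int_step_ind: x => // x; rewrite zpowS.
  split=> [->|]; first by rewrite heisZME; apply: mkZ_eq; ring.
  move/(canRL (mulgK _)) ->; rewrite heisZVE heisZME; apply: mkZ_eq; ring.
have -> : ((mkZ 1 0 0) * (mkZ 0 1 0) / (mkZ 1 0 0) / (mkZ 0 1 0)) = (mkZ 0 0 1).
  by rewrite !heisZVE !heisZME; apply: mkZ_eq; ring.
have -> : zpow (mkZ 0 0 1) z = (mkZ 0 0 z).
  elim/int_step_ind: z => // z; rewrite zpowS.
  split=> [->|]; first by rewrite heisZME; apply: mkZ_eq; ring.
  move/(canRL (mulgK _)) ->; rewrite heisZVE heisZME; apply: mkZ_eq; ring.
by rewrite !heisZME; apply: mkZ_eq; ring.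
Qed.

Lemma heis_ofM p q : heis_of (p * q) = heis_of p * heis_of q.
Proof. by apply: (can_inj heis_coordK); rewrite heis_coordM !heis_ofK. Qed.

Lemma heis_ofV p : heis_of p^-1 = (heis_of p)^-1.
Proof. by apply: (can_inj heis_coordK); rewrite heis_coordV !heis_ofK. Qed.

End Coordinates.

(** * Word length and the size of coordinates *)

Section Length.
Local Open Scope group_scope.

Local Notation wl := (word_length heis_S).

Lemma word_length_leq n x : is_product heis_S n x -> (wl x <= n)%N.
Proof. by have [_ le_wl] := heis_word_lengthP x => /le_wl. Qed.

Lemma word_length1 : wl 1 = 0%N.
Proof.
apply/eqP; rewrite -leqn0; apply: word_length_leq.
by exists [::]; split; rewrite ?big_nil.
Qed.

Lemma word_length_gen g : heis_S g -> (wl g <= 1)%N.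
Proof.
move=> Sg; apply: word_length_leq; exists [:: g].
by split=> //; [move=> h; rewrite inE => /eqP -> | rewrite big_seq1].
Qed.

Lemma word_lengthM x y : (wl (x * y) <= wl x + wl y)%N.
Proof.
have [[s [ss sS xs]] _] := heis_word_lengthP x.
have [[t [st tS yt]] _] := heis_word_lengthP y.
apply: word_length_leq; exists (s ++ t); split; last by rewrite big_cat /= -xs -yt.
  by rewrite size_cat -ss -st.
by move=> g; rewrite mem_cat => /orP[/sS|/tS].
Qed.

Lemma heis_SV g : heis_S g -> heis_S g^-1.
Proof.
case=> [[[->|->]|->]|->]; rewrite ?invgK.
- by left; right.
- by right.
- by left; left; left.
- by left; left; right.
Qed.

Lemma word_lengthV x : (wl x^-1 <= wl x)%N.
Proof.
have [[s [ss sS xs]] _] := heis_word_lengthP x.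
apply: word_length_leq; exists (rev (map (fun g => g^-1) s)); split.
- by rewrite size_rev size_map.
- by move=> g; rewrite mem_rev => /mapP[h /sS Sh ->]; exact: heis_SV.
- rewrite [in LHS]xs; elim: {ss sS xs} s => [|g s IHs].
    by rewrite !big_nil invg1.
  by rewrite /= rev_cons -cats1 big_cat big_seq1 big_cons invgM IHs.
Qed.

Lemma word_lengthX x n : (wl (x ^+ n) <= n * wl x)%N.
Proof.
elim: n => [|n IHn]; first by rewrite word_length1.
by rewrite expgS mulSn (leq_trans (word_lengthM _ _)) // leq_add2l.
Qed.

Lemma word_length_zpow x n : (wl (zpow x n) <= `|n|%N * wl x)%N.
Proof.
case: n => n; first exact: word_lengthX.
by rewrite NegzE abszN /= (leq_trans (word_lengthV _)) // word_lengthX.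
Qed.

Lemma word_length_x (x : int) : (wl (heis_of (mkZ x 0 0)) <= `|x|)%N.
Proof.
rewrite /heis_of /= mul1g mulg1 (leq_trans (word_length_zpow _ _)) //.
rewrite -[leqRHS]muln1 leq_mul2l word_length_gen ?orbT //.
by left; left; left.
Qed.

Lemma word_length_y (y : int) : (wl (heis_of (mkZ 0 y 0)) <= `|y|)%N.
Proof.
rewrite /heis_of /= !mulg1 (leq_trans (word_length_zpow _ _)) //.
rewrite -[leqRHS]muln1 leq_mul2l word_length_gen ?orbT //.
by left; left; right.
Qed.

(** The centre is quadratically distorted: [a^q, b^m] = c^(q m), so that writing
    z = q m + r costs a word of length O(m) only. *)
Lemma word_length_box (m : nat) (x y z : int) :
  (0 < m)%N -> (`|x| <= m)%N -> (`|y| <= m)%N -> (`|z| <= m * m)%N ->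
  (wl (heis_of (mkZ x y z)) <= 10 * m)%N.
Proof.
move=> m0 xm ym zm.
pose q := (z %/ m%:Z)%Z; pose r := (z %% m%:Z)%Z.
have m0' : m%:Z != 0%R by lia.
have zE : z = (q * m%:Z + r)%R by exact: divz_eq.
have r0 : (0 <= r)%R by exact: modz_ge0.
have rm : (r < m%:Z)%R by apply: ltz_pmod; lia.
have qm : (`|q| <= m)%N by nia.
have -> : mkZ x y z = mkZ 0 y 0 * mkZ x 0 0 *
    (mkZ q 0 0 * mkZ 0 m 0 * mkZ (- q) 0 0 * mkZ 0 (- m%:Z) 0) *
    (mkZ r 0 0 * mkZ 0 1 0 * mkZ (- r) 0 0 * mkZ 0 (-1) 0).
  by rewrite zE !heisZME; apply: mkZ_eq; ring.
rewrite !heis_ofM.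
have lx := word_length_x; have ly := word_length_y.
have addl u v j k : (wl u <= j)%N -> (wl v <= k)%N -> (wl (u * v) <= j + k)%N.
  by move=> uj vk; rewrite (leq_trans (word_lengthM _ _)) // leq_add.
set j := (10 * m)%N.
have : (`|y| + `|x| + (`|q| + `|m%:Z| + `|(- q)%R| + `|(- m%:Z)%R|) +
   (`|r| + `|1%R : int| + `|(- r)%R| + `|(-1)%R : int|) <= j)%N by lia.
move=> le_j; apply: leq_trans le_j.
by do ![exact: lx|exact: ly|apply: (addl _ _ _ _)].
Qed.

(** A generator changes x and y by at most 1, hence z by at most |x|, which is
    at most the number of letters read so far. *)
Lemma coord_le_product n g : is_product heis_S n g ->
  let p := heis_coord g in
  [/\ (`|p.1.1| <= n)%N, (`|p.1.2| <= n)%N & (`|p.2| <= n * n)%N].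
Proof.
move=> [s [<- sS ->]] {n g}; elim: s sS => [|g s IHs] sS.
  by rewrite big_nil heis_coord1.
have /= := IHs _; case=> [h hs|]; first by apply: sS; rewrite inE hs orbT.
have /sS : g \in g :: s by rewrite mem_head.
rewrite big_cons heis_coordM /=.
elim/mkZP: (heis_coord (\prod_(j <- s) j)) => x y z Sg.
have [-> | [-> | [-> | ->]]] : heis_coord g = mkZ 1 0 0 \/
    heis_coord g = mkZ 0 1 0 \/ heis_coord g = mkZ (-1) 0 0 \/
    heis_coord g = mkZ 0 (-1) 0.
  case: Sg => [[[->|->]|->]|->];
    rewrite ?heis_coordV ?heis_coord_a ?heis_coord_b ?heisZVE; tauto.
all: rewrite /= => xs ys zs; split; nia.
Qed.

Lemma coord_le_length g :
  let p := heis_coord g in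
  [/\ (`|p.1.1| <= wl g)%N, (`|p.1.2| <= wl g)%N & (`|p.2| <= wl g * wl g)%N].
Proof. by apply: coord_le_product; have [] := heis_word_lengthP g. Qed.

End Length.

(** * A vertical-horizontal inequality for finite actions of the Heisenberg group *)

Section SquaredModulus.
Variable R : rcfType.
Local Notation C := (complex R).
Implicit Types x y z w : C.

Definition sqmod z : R := complex.Re z ^+ 2 + complex.Im z ^+ 2.

Lemma sqmod_ge0 z : 0 <= sqmod z.
Proof. by rewrite addr_ge0 ?sqr_ge0. Qed.

Lemma sqmodM x y : sqmod (x * y) = sqmod x * sqmod y.
Proof. by case: x y => [a b] [c d]; rewrite /sqmod /=; ring. Qed.

Lemma sqmod1 : sqmod 1 = 1.
Proof. by rewrite /sqmod /=; ring. Qed.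

Lemma sqmodX x n : sqmod (x ^+ n) = sqmod x ^+ n.
Proof. by elim: n => [|n IHn]; rewrite ?sqmod1 // !exprS sqmodM IHn. Qed.

Lemma sqmodN x : sqmod (- x) = sqmod x.
Proof. by case: x => [a b]; rewrite /sqmod /=; ring. Qed.

Lemma sqmod_conj x : sqmod (conjc x) = sqmod x.
Proof. by case: x => [a b]; rewrite /sqmod /=; ring. Qed.

Lemma sqmodE z : (sqmod z)%:C%C = z * conjc z.
Proof.
case: z => [a b]; rewrite /sqmod; apply/eqP; rewrite eq_complex /=.
by apply/andP; split; apply/eqP; ring.
Qed.

Lemma sqmod_root n z : (0 < n)%N -> z ^+ n = 1 -> sqmod z = 1.
Proof.
move=> n0 zn; apply/eqP; rewrite -(@pexpr_eq1 _ _ n) ?sqmod_ge0 //.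
by rewrite -sqmodX zn sqmod1.
Qed.

Lemma conj_mul_unit z : sqmod z = 1 -> z * conjc z = 1.
Proof. by rewrite -sqmodE => ->. Qed.

Lemma sqmod_realM (a : R) z : sqmod (a%:C%C * z) = a ^+ 2 * sqmod z.
Proof. by rewrite sqmodM /sqmod /=; ring. Qed.

Lemma sqmodD x y : sqmod (x + y) <= 2 * sqmod x + 2 * sqmod y.
Proof.
case: x y => [a b] [c d]; rewrite /sqmod /=.
have := sqr_ge0 (a - c); have := sqr_ge0 (b - d); nra.
Qed.

(** The weights of Young's inequality are chosen for [single_frequency]: the terms z
    there have to add up to at most half of the left-hand side. *)
Lemma Re_mul_conj_le x y z :
  complex.Re (x * conjc (y + z)) <= 5 / 2 * sqmod x + sqmod y / 2 + sqmod z / 8.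
Proof.
case: x y z => [a b] [c d] [e f]; rewrite /sqmod /=.
have := sqr_ge0 (a - c); have := sqr_ge0 (b - d).
have := sqr_ge0 (4 * a - e); have := sqr_ge0 (4 * b - f); nra.
Qed.

Lemma sqmod_sub1_le4 z : sqmod z = 1 -> sqmod (z - 1) <= 4.
Proof.
by move=> z1; have := sqmodD z (-1); rewrite sqmodN sqmod1 z1; lra.
Qed.

Lemma sqmod_expX2_sub1 z j : sqmod z = 1 ->
  sqmod (z ^+ (2 ^ j) - 1) <= 4 ^+ j * sqmod (z - 1).
Proof.
move=> z1; elim: j => [|j IHj]; first by rewrite expr0 mul1r.
rewrite expnSr exprM; set w := z ^+ (2 ^ j).
have w1 : sqmod w = 1 by rewrite sqmodX z1 expr1n.
have -> : w ^+ 2 - 1 = (w + 1) * (w - 1) by ring.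
rewrite sqmodM exprS -mulrA ler_pM ?sqmod_ge0 //.
by have := sqmodD w 1; rewrite w1 sqmod1; lra.
Qed.

(** Squaring z at most doubles |z - 1|, which moreover is at most 2, so with
    d = |z - 1| the summand is at most the minimum of 4^j d^2 and 4 / 4^j.  Both
    geometric regimes are dominated at once by the increments of 14 d t / (t + 1)
    along the points t = 4^j d, and these telescope. *)
Lemma sum_sqmod_expX4_sub1 z (d : R) (J : nat) :
  sqmod z = 1 -> 0 <= d -> d ^+ 2 = sqmod (z - 1) ->
  \sum_(j < J) sqmod (z ^+ (4 ^ j) - 1) / 4 ^+ j <= 14 * d.
Proof.
move=> z1 d0 dE.
pose G (j : nat) : R := 14 * d * (4 ^+ j * d / (4 ^+ j * d + 1)).
have X1 (j : nat) : 1 <= 4 ^+ j :> R by rewrite exprn_ege1 ?ler1n.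
have step (j : nat) : sqmod (z ^+ (4 ^ j) - 1) / 4 ^+ j <= G j.+1 - G j.
  have := @sqmod_sub1_le4 (z ^+ (4 ^ j)); rewrite sqmodX z1 expr1n => /(_ erefl).
  have := sqmod_expX2_sub1 (2 * j) z1; rewrite expnM -dE exprM.
  rewrite [4 ^+ 2](_ : _ = 4 * 4) ?expr2 // exprMn.
  rewrite /G exprS; set s := sqmod _; set t := 4 ^+ j.
  have t1 : 1 <= t by exact: X1.
  have td : 0 <= t * d by rewrite mulr_ge0 //; lra.
  move=> s1 s2.
  have -> : 14 * d * (4 * t * d / (4 * t * d + 1)) - 14 * d * (t * d / (t * d + 1)) =
      42 * (t * d ^+ 2) / ((4 * t * d + 1) * (t * d + 1)).
    by field; apply/andP; split; apply/eqP; nra.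
  rewrite ler_pdivrMr; last by lra.
  rewrite mulrAC ler_pdivlMr; last by nra.
  have [le1|ge1] := leP (t * d) 1.
    have : s * ((4 * t * d + 1) * (t * d + 1)) <= t * t * d ^+ 2 * 10.
      apply: ler_pM; rewrite ?sqmod_ge0 //; nra.
    have : 0 <= t * t * d ^+ 2 by nra.
    nra.
  have : s * ((4 * t * d + 1) * (t * d + 1)) <= 4 * (10 * (t * d) ^+ 2).
    apply: ler_pM; rewrite ?sqmod_ge0 //; nra.
  nra.
have : \sum_(j < J) (G j.+1 - G j) <= 14 * d.
  rewrite -(big_mkord xpredT (fun j => G j.+1 - G j)) telescope_sumr //.
  rewrite {2}/G expr0 mul1r; have : G J <= 14 * d.
    rewrite /G ler_piMr //; first lra.
    have := X1 J; set t := 4 ^+ J => t1.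
    by rewrite ler_pdivrMr; nra.
  have : 0 <= 14 * d * (d / (d + 1)) by rewrite mulr_ge0 ?divr_ge0; lra.
  lra.
by apply: le_trans; apply: ler_sum.
Qed.

End SquaredModulus.

Section Parseval.
Variable R : rcfType.
Local Notation C := (complex R).

Lemma prim_root_exists n : (0 < n)%N -> exists z : C, n.-primitive_root z.
Proof.
move=> n0; pose p : {poly C} := 'X^n - 1.
have [r Dp] := closed_field_poly_normal p.
rewrite (monicP _) ?monicXnsubC // scale1r in Dp.
have rn1 : all n.-unity_root r by apply/allP => z; rewrite -root_prod_XsubC -Dp.
have sz_r : (n < (size r).+1)%N.
  by rewrite -(size_prod_XsubC r id) -Dp size_XnsubC.
have [|z _ zP] := hasP (has_prim_root n0 rn1 _ sz_r); last by exists z.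
by rewrite -separable_prod_XsubC -Dp separable_Xn_sub_1 // pnatr_eq0 -lt0n.
Qed.

Lemma Parseval n (z : C) (u : 'I_n -> C) : n.-primitive_root z ->
  \sum_(j < n) sqmod (\sum_(k < n) z ^+ j ^+ k * u k) =
  n%:R * \sum_(k < n) sqmod (u k).
Proof.
move=> zP; have n0 := prim_order_gt0 zP.
have z1 : sqmod z = 1 by apply: (sqmod_root n0); exact: prim_expr_order.
apply: (@complexI R); rewrite rmorphM rmorph_nat !rmorph_sum /=.
transitivity (\sum_(j < n) \sum_(k < n) \sum_(l < n)
    u k * conjc (u l) * (z ^+ k * conjc z ^+ l) ^+ j).
  apply: eq_bigr => j _; rewrite sqmodE (rmorph_sum (@conjc R)) big_distrlr /=.
  apply: eq_bigr => k _; apply: eq_bigr => l _.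
  rewrite !rmorphM !rmorphXn /= exprMn -!exprM !(mulnC j).
  by rewrite mulrACA mulrC.
rewrite exchange_big /= mulr_sumr; apply: eq_bigr => k _.
rewrite exchange_big /= (bigD1 k) //= [X in _ + X]big1 ?addr0 => [|l lk].
  rewrite sqmodE -mulr_sumr mulrC; congr (_ * _).
  under eq_bigr do rewrite -exprMn conj_mul_unit // !expr1n.
  by rewrite sumr_const card_ord.
rewrite -mulr_sumr; set w := z ^+ k * conjc z ^+ l.
have w1 : w != 1.
  apply: contra lk => /eqP w1; rewrite -val_eqE /=.
  have /eqP : z ^+ l = z ^+ k.
    have -> : z ^+ k = w * z ^+ l; last by rewrite w1 mul1r.
    rewrite /w -mulrA -exprMn [conjc z * z]mulrC conj_mul_unit //.
    by rewrite expr1n mulr1.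
  by rewrite (eq_prim_root_expr zP) !modn_small.
have wn : w ^+ n = 1.
  have cn : conjc z ^+ n = 1.
    by rewrite -(rmorphXn (@conjc R)) (prim_expr_order zP) rmorph1.
  by rewrite /w exprMn -!exprM !(mulnC _ n) !exprM cn (prim_expr_order zP) !expr1n mulr1.
have := subrX1 w n; rewrite wn subrr => /esym/eqP.
by rewrite mulf_eq0 subr_eq0 (negPf w1) /= => /eqP ->; rewrite mulr0.
Qed.

End Parseval.

Section SingleFrequency.
Variables (R : rcfType) (G : finType) (al be ga : G -> G).
Local Notation C := (complex R).
Hypotheses (al_inj : injective al) (be_inj : injective be).
Hypothesis beal : forall g, be (al g) = ga (al (be g)).

(** Pair (1 - 1/z) a b u = (a b - b a) u with a b u, where a, b, c act on functions
    by composition with [al], [be], [ga].  Each commutator term contains two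
    differences, of which one is moved to the other factor of the inner product:
    there a b u - b u is a difference of u up to an error of size |1 - z| |u|, so
    every term is quadratic in differences or absorbed by the left-hand side. *)
Lemma single_frequency (z : C) (d : R) (u : G -> C) :
  sqmod z = 1 -> 0 <= d -> d ^+ 2 = sqmod (z - 1) ->
  (forall g, u (ga g) = z * u g) ->
  d * \sum_g sqmod (u g) <=
  6 * (\sum_g sqmod (u (al g) - u g) + \sum_g sqmod (u (be g) - u g)).
Proof.
move=> z1 d0 dE uga.
have sal (F : G -> R) : \sum_g F (al g) = \sum_g F g by rewrite [RHS](reindex_inj al_inj).
have sbe (F : G -> R) : \sum_g F (be g) = \sum_g F g by rewrite [RHS](reindex_inj be_inj).
have salC (F : G -> C) : \sum_g F (al g) = \sum_g F g by rewrite [RHS](reindex_inj al_inj).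
have sbeC (F : G -> C) : \sum_g F (be g) = \sum_g F g by rewrite [RHS](reindex_inj be_inj).
set A := \sum_g sqmod (u (al g) - u g); set B := \sum_g sqmod (u (be g) - u g).
set V := \sum_g sqmod (u g).
have AB0 : 0 <= 6 * (A + B).
  by rewrite mulr_ge0 // addr_ge0 // sumr_ge0 // => g _; exact: sqmod_ge0.
have [->|dn0] := eqVneq d 0; first by rewrite mul0r.
have d2 : d ^+ 2 <= 2 * d.
  have : d ^+ 2 <= 4 by rewrite dE sqmod_sub1_le4.
  nra.
have uab g : u (be (al g)) = z * u (al (be g)) by rewrite beal uga.
have zz : conjc z * z = 1 by rewrite mulrC conj_mul_unit.
have uba g : u (al (be g)) = conjc z * u (be (al g)) by rewrite uab mulrA zz mul1r.
(* [P] comes from <(a - 1)(b - 1) u, a b u> and [Q] from <(b - 1)(a - 1) u, a b u> *)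
pose P g := (u (be g) - u g) *
  conjc (z * (u (be g) - u (al (be g))) + (1 - z) * u (be g)).
pose Q g := (u (al g) - u g) *
  conjc (z * (conjc z * (u (al g) - u (be (al g)))) + z * ((1 - conjc z) * u (al g))).
have key : (1 - conjc z) * V%:C%C = \sum_g P g - \sum_g Q g.
  pose S1 g := (u (be g) - u g) * conjc (u (be g)).
  pose S2 g := (u (al g) - u g) * conjc (z * u (al g)).
  pose T1 g := (u (be g) - u g) * conjc (u (be (al g))).
  pose T2 g := (u (al g) - u g) * conjc (u (be (al g))).
  have PE : \sum_g P g = \sum_g S1 (al g) - \sum_g T1 g.
    rewrite salC -sumrB; apply: eq_bigr => g _.
    rewrite /P /S1 /T1 uab -mulrBr -rmorphB; congr (_ * conjc _); ring.
  have QE : \sum_g Q g = \sum_g S2 (be g) - \sum_g T2 g.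
    rewrite sbeC -sumrB; apply: eq_bigr => g _.
    rewrite /Q /S2 /T2 -mulrBr -rmorphB; congr (_ * conjc _).
    have -> : z * (conjc z * (u (al g) - u (be (al g)))) = u (al g) - u (be (al g)).
      by rewrite mulrA [z * _]mulrC zz mul1r.
    have -> : z * ((1 - conjc z) * u (al g)) = z * u (al g) - u (al g).
      by rewrite mulrA mulrBr [z * conjc z]mulrC zz; ring.
    by ring.
  rewrite PE QE -!sumrB /V rmorph_sum /= -sbeC -salC mulr_sumr.
  apply: eq_bigr => g _; rewrite sqmodE mulrA mulrBl -uba mul1r.
  rewrite /S1 /S2 /T1 /T2 -uab; ring.
have dC : sqmod (1 - conjc z) = d ^+ 2.
  by rewrite dE -(sqmod_conj (z - 1)) rmorphB rmorph1 -sqmodN opprB.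
have dn0C : d%:C%C != 0 by rewrite -(rmorph0 (real_complex R)) (inj_eq (@complexI R)).
(* rotating by the phase of 1 - 1/z makes the left-hand side real and nonnegative *)
have [w w1 wd] : exists2 w, sqmod w = 1 & w * (1 - conjc z) = d%:C%C.
  exists (conjc (1 - conjc z) / d%:C%C).
    by rewrite mulrC -fmorphV sqmod_realM sqmod_conj dC exprVn mulVf // sqrf_eq0.
  by rewrite mulrAC [_ * (1 - _)]mulrC -sqmodE dC expr2 rmorphM mulfK.
have dV : d * V = \sum_g complex.Re (w * P g) + \sum_g complex.Re (- w * Q g).
  transitivity (complex.Re (w * ((1 - conjc z) * V%:C%C))).
    by rewrite mulrA wd /= mulr0 subr0.
  rewrite key mulrBr -mulNr !mulr_sumr raddfD /= !raddf_sum.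
  by [].
have bP : \sum_g complex.Re (w * P g) <= 5 / 2 * B + A / 2 + d ^+ 2 * V / 8.
  have -> : A = \sum_g sqmod (z * (u (be g) - u (al (be g)))).
    by rewrite /A -sbe; apply: eq_bigr => g _; rewrite sqmodM z1 mul1r -sqmodN opprB.
  have -> : d ^+ 2 * V = \sum_g sqmod ((1 - z) * u (be g)).
    rewrite /V -sbe mulr_sumr; apply: eq_bigr => g _.
    by rewrite sqmodM dE -sqmodN opprB.
  rewrite /B mulr_sumr !mulr_suml -!big_split /=; apply: ler_sum => g _.
  rewrite /P mulrA; apply: le_trans (Re_mul_conj_le _ _ _) _.
  by rewrite sqmodM w1 mul1r.
have bQ : \sum_g complex.Re (- w * Q g) <= 5 / 2 * A + B / 2 + d ^+ 2 * V / 8.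
  have -> : B = \sum_g sqmod (z * (conjc z * (u (al g) - u (be (al g))))).
    rewrite /B -sal; apply: eq_bigr => g _.
    by rewrite !sqmodM sqmod_conj z1 !mul1r -sqmodN opprB.
  have -> : d ^+ 2 * V = \sum_g sqmod (z * ((1 - conjc z) * u (al g))).
    rewrite /V -sal mulr_sumr; apply: eq_bigr => g _.
    by rewrite !sqmodM z1 mul1r dC.
  rewrite /A mulr_sumr !mulr_suml -!big_split /=; apply: ler_sum => g _.
  rewrite /Q [- w * _]mulrA; apply: le_trans (Re_mul_conj_le _ _ _) _.
  by rewrite [sqmod (- w * _)]sqmodM sqmodN w1 mul1r.
have V0 : 0 <= V by rewrite sumr_ge0 // => g _; exact: sqmod_ge0.
have : d ^+ 2 * V <= 2 * d * V by rewrite ler_wpM2r.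
lra.
Qed.

End SingleFrequency.

Section VerticalHorizontal.
Variables (R : rcfType) (G : finType) (al be ga : G -> G) (N : nat).
Local Notation C := (complex R).
Hypotheses (al_inj : injective al) (be_inj : injective be).
Hypothesis (N0 : (0 < N)%N) (gaN : forall g, iter N ga g = g).
Hypotheses (alga : forall g, al (ga g) = ga (al g)).
Hypotheses (bega : forall g, be (ga g) = ga (be g)).
Hypotheses (beal : forall g, be (al g) = ga (al (be g))).

Lemma ga_inj : injective ga.
Proof.
apply: (can_inj (g := iter N.-1 ga)) => g.
by rewrite -iterSr prednK.
Qed.

Lemma iter_commute (f : G -> G) : (forall g, f (ga g) = ga (f g)) ->
  forall k g, f (iter k ga g) = iter k ga (f g).
Proof. by move=> fga; elim=> [//|k IHk] g; rewrite !iterS fga IHk. Qed.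

(** The component of [v] on which composition with [ga] acts as the conjugate of
    [z], multiplied by [N]. *)
Definition spectral (z : C) (v : G -> C) (g : G) : C :=
  \sum_(k < N) z ^+ k * v (iter k ga g).

Lemma spectralB z v w g :
  spectral z (fun h => v h - w h) g = spectral z v g - spectral z w g.
Proof. by rewrite -sumrB; apply: eq_bigr => k _; rewrite mulrBr. Qed.

Lemma spectral_comp z v f g : (forall h, f (ga h) = ga (f h)) ->
  spectral z (fun h => v (f h)) g = spectral z v (f g).
Proof. by move=> fga; apply: eq_bigr => k _; rewrite iter_commute. Qed.

Lemma spectral_ga z v g : z ^+ N = 1 ->
  spectral z v (ga g) = conjc z * spectral z v g.
Proof.
move=> zN; have z1 := sqmod_root N0 zN.
have cz : conjc z * z = 1 by rewrite mulrC conj_mul_unit.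
rewrite -[LHS]mul1r -cz -mulrA; congr (_ * _).
have E : \sum_(k < N.+1) z ^+ k * v (iter k ga g) = spectral z v g + v g.
  by rewrite big_ord_recr /= zN gaN mul1r.
apply: (addIr (v g)); rewrite -E big_ord_recl /= expr0 mul1r addrC; congr (_ + _).
rewrite /spectral mulr_sumr; apply: eq_bigr => k _.
by rewrite mulrA -exprS /bump /= -iterS iterSr.
Qed.

Lemma spectral_iter z v m g : z ^+ N = 1 ->
  spectral z v (iter m ga g) = conjc z ^+ m * spectral z v g.
Proof.
move=> zN; elim: m => [|m IHm]; first by rewrite mul1r.
by rewrite iterS spectral_ga // IHm mulrA -exprS.
Qed.

Lemma spectral_norm (z : C) v : N.-primitive_root z ->
  \sum_(j < N) \sum_g sqmod (spectral (z ^+ j) v g) =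
  N%:R ^+ 2 * \sum_g sqmod (v g).
Proof.
move=> zP; rewrite exchange_big /=.
under eq_bigr do rewrite (Parseval _ zP).
rewrite -mulr_sumr expr2 -mulrA; congr (_ * _).
rewrite exchange_big /= mulr_natl -[in RHS](card_ord N) -sumr_const.
apply: eq_bigr => k _; elim: {k} (k : nat) => [//|k <-].
by rewrite [RHS](reindex_inj ga_inj); apply: eq_bigr => g _; rewrite -iterSr.
Qed.

(** Decompose along the characters of the cyclic group generated by the central
    element; on each frequency the bound is [single_frequency] summed over scales
    by [sum_sqmod_expX4_sub1], and Parseval reassembles the pieces. *)
Lemma vertical_horizontalC (v : G -> C) (J : nat) :
  \sum_(j < J) (\sum_g sqmod (v (iter (4 ^ j) ga g) - v g)) / 4 ^+ j <=
  84 * (\sum_g sqmod (v (al g) - v g) + \sum_g sqmod (v (be g) - v g)).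
Proof.
have [z zP] := @prim_root_exists R N N0.
have zj (j : nat) : (z ^+ j) ^+ N = 1.
  by rewrite exprAC (prim_expr_order zP) expr1n.
have N2 : 0 < N%:R ^+ 2 :> R by rewrite exprn_gt0 // ltr0n.
rewrite -(ler_pM2l N2) mulr_sumr.
under eq_bigr do rewrite mulrA -(spectral_norm _ zP) mulr_suml.
rewrite exchange_big mulrCA mulrDr -!(spectral_norm _ zP) -big_split /= mulr_sumr.
apply: ler_sum => l _; set y := z ^+ l.
pose d := Num.sqrt (sqmod (conjc y - 1)).
have d0 : 0 <= d by exact: sqrtr_ge0.
have dE : d ^+ 2 = sqmod (conjc y - 1) by rewrite sqr_sqrtr // sqmod_ge0.
have y1 : sqmod (conjc y) = 1 by rewrite sqmod_conj (sqmod_root N0 (zj l)).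
have := single_frequency al_inj be_inj beal y1 d0 dE
  (fun g => @spectral_ga y v g (zj l)).
rewrite -/y.
have := @sum_sqmod_expX4_sub1 _ _ _ J y1 d0 dE.
set S := \sum_g sqmod (spectral y v g).
have S0 : 0 <= S by rewrite sumr_ge0 // => g _; exact: sqmod_ge0.
under [X in _ <= 84 * (X + _)]eq_bigr do rewrite spectralB spectral_comp //.
under [X in _ <= 84 * (_ + X)]eq_bigr do rewrite spectralB spectral_comp //.
have -> : \sum_(j < J) (\sum_g sqmod (spectral y
      (fun g => v (iter (4 ^ j) ga g) - v g) g)) / 4 ^+ j =
    (\sum_(j < J) sqmod (conjc y ^+ (4 ^ j) - 1) / 4 ^+ j) * S.
  rewrite mulr_suml; apply: eq_bigr => j _; rewrite mulrAC; congr (_ / _).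
  rewrite mulr_sumr; apply: eq_bigr => g _.
  rewrite spectralB (spectral_comp _ v) ?spectral_iter //.
  - by rewrite -sqmodM mulrBl mul1r.
  - exact: zj.
  by move=> h; rewrite -iterSr iterS.
move=> le14 le6; apply: (le_trans (ler_wpM2r S0 le14)).
by lra.
Qed.

Lemma vertical_horizontal (v : G -> R) (J : nat) :
  \sum_(j < J) (\sum_g (v (iter (4 ^ j) ga g) - v g) ^+ 2) / 4 ^+ j <=
  84 * (\sum_g (v (al g) - v g) ^+ 2 + \sum_g (v (be g) - v g) ^+ 2).
Proof.
have E (a b : R) : sqmod (a%:C%C - b%:C%C) = (a - b) ^+ 2.
  by rewrite /sqmod /=; ring.
have := vertical_horizontalC (fun g => (v g)%:C%C) J.
under eq_bigr do under eq_bigr do rewrite E.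
under [X in _ <= 84 * (X + _) -> _]eq_bigr do rewrite E.
by under [X in _ <= 84 * (_ + X) -> _]eq_bigr do rewrite E.
Qed.

End VerticalHorizontal.

(** * Cutoff functions adapted to boxes *)

Section Cutoff.
Variable R : realFieldType.
Implicit Types (s t : R) (p : heisZ) (n : nat).

Definition ramp t : R := Num.min 1 (Num.max 0 (2 - t)).

Lemma ramp_ge0 t : 0 <= ramp t.
Proof. by rewrite /ramp le_min ler01 le_max lexx. Qed.

Lemma ramp_le1 t : ramp t <= 1.
Proof. by rewrite /ramp ge_min lexx. Qed.

Lemma ramp_eq1 t : t <= 1 -> ramp t = 1.
Proof. by move=> t1; apply/min_idPl; rewrite le_max; apply/orP; right; lra. Qed.

Lemma ramp_eq0 t : 2 <= t -> ramp t = 0.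
Proof.
move=> t2; rewrite /ramp (_ : Num.max 0 (2 - t) = 0); last by apply/max_idPl; lra.
by apply/min_idPr.
Qed.

Lemma rampP t :
  [\/ t <= 1 /\ ramp t = 1, 1 <= t <= 2 /\ ramp t = 2 - t | 2 <= t /\ ramp t = 0].
Proof.
have [t1|t1] := leP t 1; first by constructor 1; rewrite ramp_eq1.
have [t2|t2] := leP 2 t; first by constructor 3; rewrite ramp_eq0.
constructor 2; split; first by apply/andP; split; lra.
rewrite /ramp (_ : Num.max 0 (2 - t) = 2 - t); last by apply/max_idPr; lra.
by apply/min_idPr; lra.
Qed.

Lemma ramp_lip s t : `|ramp s - ramp t| <= `|s - t|.
Proof.
have := ler_norm (s - t); have := ler_norm (t - s).
rewrite ler_norml (distrC t s) => ? ?.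
by case: (rampP s) (rampP t) => [][? ->] [][? ->]; apply/andP; split; lra.
Qed.

Definition isize (x : int) : R := (`|x|%N)%:R.

Lemma isizeE (x : int) : isize x = `|x%:~R|.
Proof. by rewrite /isize -intr_norm. Qed.

Lemma isizeB (x y : int) : `|isize (x + y) - isize x| <= isize y.
Proof.
rewrite !isizeE intrD.
by apply: le_trans (ler_dist_dist _ _) _; rewrite addrAC subrr add0r.
Qed.

Definition cutoff n p : R :=
  ramp (isize p.1.1 / n%:R) * ramp (isize p.1.2 / n%:R) *
  ramp (isize p.2 / (n * n)%:R).

Lemma cutoff_ge0 n p : 0 <= cutoff n p.
Proof. by rewrite !mulr_ge0 ?ramp_ge0. Qed.

Lemma cutoff_le1 n p : cutoff n p <= 1.
Proof. by rewrite /cutoff !mulr_ile1 ?mulr_ge0 ?ramp_ge0 ?ramp_le1. Qed.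

Lemma cutoff_eq1 n p : (0 < n)%N ->
  (`|p.1.1| <= n)%N -> (`|p.1.2| <= n)%N -> (`|p.2| <= n * n)%N ->
  cutoff n p = 1.
Proof.
move=> n0 xn yn zn; rewrite /cutoff !ramp_eq1 ?mulr1 //;
  by rewrite ler_pdivrMr ?ltr0n ?muln_gt0 ?n0 // mul1r ler_nat.
Qed.

Lemma ramp_neq0 (m : nat) (x : int) : (0 < m)%N -> ramp (isize x / m%:R) != 0 ->
  (`|x| < 2 * m)%N.
Proof.
move=> m0; apply: contraNltn => xm; apply/eqP/ramp_eq0.
by rewrite ler_pdivlMr ?ltr0n // -natrM ler_nat.
Qed.

Lemma cutoff_neq0 n p : (0 < n)%N -> cutoff n p != 0 ->
  [/\ (`|p.1.1| < 2 * n)%N, (`|p.1.2| < 2 * n)%N & (`|p.2| < 2 * (n * n))%N].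
Proof.
move=> n0; rewrite /cutoff !mulf_eq0 !negb_or -andbA => /and3P[xn yn zn].
by split; apply: ramp_neq0 => //; rewrite muln_gt0 n0.
Qed.

Lemma ramp_step (m : nat) (x y : int) : (0 < m)%N ->
  `|ramp (isize (x + y) / m%:R) - ramp (isize x / m%:R)| <= isize y / m%:R.
Proof.
move=> m0; apply: le_trans (ramp_lip _ _) _.
rewrite -mulrBl normrM [`|_^-1|]ger0_norm ?invr_ge0 //.
by rewrite ler_wpM2r ?invr_ge0 // isizeB.
Qed.

Lemma cutoff_stepa n p : (0 < n)%N ->
  `|cutoff n (p * mkZ 1 0 0)%g - cutoff n p| <= 3 / n%:R.
Proof.
move=> n0; elim/mkZP: p => x y z; rewrite heisZME /cutoff /= mulr0 !addr0.
rewrite -!mulrA -mulrBl normrM; set r := _ * ramp _.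
have r0 : 0 <= r by rewrite mulr_ge0 ?ramp_ge0.
have r1 : r <= 1 by rewrite mulr_ile1 ?ramp_ge0 ?ramp_le1.
rewrite (ger0_norm r0); have := ramp_step x 1 n0.
rewrite (_ : isize 1 = 1) // => /(ler_wpM2r r0) /le_trans; apply.
have n0' : 0 <= (n%:R : R)^-1 by rewrite invr_ge0.
set k := _^-1 in n0' *; nra.
Qed.

(** Right multiplication by b moves z by x, and |x| < 2 n where the first factor does
    not vanish, so on the scale n^2 of z this is again a step of order 1 / n. *)
Lemma cutoff_stepb n p : (0 < n)%N ->
  `|cutoff n (p * mkZ 0 1 0)%g - cutoff n p| <= 3 / n%:R.
Proof.
move=> n0; elim/mkZP: p => x y z; rewrite heisZME /cutoff /= mulr1 !addr0.
have n0R : 0 < n%:R :> R by rewrite ltr0n.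
rewrite -!mulrA -mulrBr normrM (ger0_norm (ramp_ge0 _)).
have [->|/(ramp_neq0 n0) xn] := eqVneq (ramp (isize x / n%:R)) 0.
  by rewrite mul0r divr_ge0.
have := ramp_step y 1 n0; have nn0 : (0 < n * n)%N by rewrite muln_gt0 n0.
have := ramp_step z x nn0.
have xn' : isize x / (n * n)%:R <= 2 / n%:R.
  rewrite natrM invfM mulrA ler_pM2r ?invr_gt0 // ler_pdivrMr //.
  by rewrite -natrM ler_nat ltnW.
rewrite (_ : isize 1 = 1) //.
set ry := ramp (isize y / _); set ry' := ramp (isize (y + 1) / _).
set rz := ramp (isize z / _); set rz' := ramp (isize (z + x) / _) => hz hy.
have [ry0 ry1 rz0 rz1] : [/\ 0 <= ry, ry <= 1, 0 <= rz' & rz' <= 1].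
  by split; rewrite ?ramp_ge0 ?ramp_le1.
have -> : ry' * rz' - ry * rz = (ry' - ry) * rz' + ry * (rz' - rz) by ring.
have : `|(ry' - ry) * rz' + ry * (rz' - rz)| <= 1 / n%:R + 2 / n%:R.
  apply: le_trans (ler_normD _ _) _; rewrite !normrM (ger0_norm ry0) (ger0_norm rz0).
  apply: lerD.
    by apply: le_trans hy; rewrite ler_piMr.
  by apply: le_trans xn'; apply: le_trans hz; rewrite ler_piMl.
set a := `|_|; have -> : 1 / n%:R + 2 / n%:R = 3 / n%:R :> R.
  by rewrite -mulrDl -natr1; congr (_ / _); lra.
move=> a3; apply: le_trans a3; rewrite ler_piMl ?normr_ge0 ?ramp_le1 //.
Qed.

End Cutoff.

(** * A local inequality on boxes *)

Section FiniteModel.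
Variables (R : realType) (n : nat).
Hypothesis n0 : (0 < n)%N.
Let M := (8 * (n * n))%N.
Let N := (M + M)%N.
Let N1 : (1 < N)%N. Proof. by rewrite /N /M; lia. Qed.
Let nn : (n <= n * n)%N. Proof. by rewrite leq_pmulr. Qed.
Local Notation G := ('Z_N * 'Z_N * 'Z_N)%type.

(** Residues are read as integers in [- M, M), so that the box of interest sits in
    the middle and a step from it never wraps around. *)
Definition lift1 (i : 'Z_N) : int := (i : nat)%:Z - M%:Z.
Definition lift3 (g : G) : heisZ := mkZ (lift1 g.1.1) (lift1 g.1.2) (lift1 g.2).

Definition mod_a (g : G) : G := (g.1.1 + 1, g.1.2, g.2).
Definition mod_b (g : G) : G := (g.1.1, g.1.2 + 1, g.2 + (g.1.1 - M%:R)).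
Definition mod_c (g : G) : G := (g.1.1, g.1.2, g.2 + 1).

Lemma mod_a_inj : injective mod_a.
Proof.
move=> [[x y] z] [[x' y'] z'] E.
have /addIr -> : x + 1 = x' + 1 := congr1 (fun g : G => g.1.1) E.
have -> : y = y' := congr1 (fun g : G => g.1.2) E.
by have -> : z = z' := congr1 (fun g : G => g.2) E.
Qed.

Lemma mod_b_inj : injective mod_b.
Proof.
move=> [[x y] z] [[x' y'] z'] E.
have xE : x = x' := congr1 (fun g : G => g.1.1) E.
have /addIr -> : y + 1 = y' + 1 := congr1 (fun g : G => g.1.2) E.
have : z + (x - M%:R) = z' + (x' - M%:R) := congr1 (fun g : G => g.2) E.
by rewrite xE => /addIr ->.
Qed.

Lemma iter_mod_c k g : iter k mod_c g = (g.1.1, g.1.2, g.2 + k%:R).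
Proof.
elim: k => [|k IHk] /=; first by rewrite addr0; case: g => [[]].
by rewrite IHk /mod_c /= -addrA -mulrSr.
Qed.

Lemma iter_mod_cN g : iter N mod_c g = g.
Proof. by rewrite iter_mod_c pchar_Zp // addr0; case: g => [[]]. Qed.

Lemma lift1D (i : 'Z_N) (d : int) : 0 <= lift1 i + d + M%:Z < N%:Z ->
  lift1 (i + d%:~R) = lift1 i + d.
Proof.
move=> /andP[]; rewrite {1 2}/lift1 => ge0 ltN.
have [m mE] : exists m : nat, (i : nat)%:Z + d = m%:Z by exists `|((i : nat)%:Z + d)%R|%N; lia.
have -> : i + d%:~R = m%:R.
  by rewrite -[i in LHS]natr_Zp -[(i : nat)%:R]/(((i : nat)%:Z)%:~R) -intrD mE.
by rewrite /lift1 val_Zp_nat // modn_small; lia.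
Qed.

Let box1 (k : nat) : {set 'Z_N} := [set i | (`|lift1 i| <= k)%N].

(** Contains the points from which a step by a or b leads into the support of the
    cutoff: such a step changes z by less than 2 n. *)
Definition outer_box : {set G} :=
  finset.setX (finset.setX (box1 (2 * n)) (box1 (2 * n))) (box1 (4 * (n * n))).

(** Here z is kept nonpositive, so that multiplying by c^k with k <= n^2 does not
    leave the set where the cutoff is 1. *)
Definition inner_box : {set G} :=
  finset.setX (finset.setX (box1 n) (box1 n))
    [set i : 'Z_N | - (n * n)%:Z <= lift1 i <= 0].

(* abstracts the lifts, so that only linear integer arithmetic is left *)
Local Ltac lift_lia := rewrite ?/N ?/M;
  repeat match goal with H : context [lift1 _] |- _ => move: H end;
  repeat match goal with |- context [lift1 ?x] => move: (lift1 x) => ? end;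
  lia.

Lemma outer_boxE g : (g \in outer_box) = [&& (`|lift1 g.1.1| <= 2 * n)%N,
  (`|lift1 g.1.2| <= 2 * n)%N & (`|lift1 g.2| <= 4 * (n * n))%N].
Proof. by case: g => [[x y] z]; rewrite !finset.in_setX /box1 !finset.in_set /= andbA. Qed.

Lemma inner_boxE g : (g \in inner_box) = [&& (`|lift1 g.1.1| <= n)%N,
  (`|lift1 g.1.2| <= n)%N & - (n * n)%:Z <= lift1 g.2 <= 0].
Proof. by case: g => [[x y] z]; rewrite !finset.in_setX /box1 !finset.in_set /= !andbA. Qed.

Lemma lift3_a g : g \in outer_box -> lift3 (mod_a g) = (lift3 g * mkZ 1 0 0)%g.
Proof.
rewrite outer_boxE => /and3P[xn yn zn].
rewrite /lift3 heisZME /=; apply: mkZ_eq; rewrite ?mulr0 ?addr0 //.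
by rewrite -[1 : 'Z_N]/(1%:~R) lift1D //; lift_lia.
Qed.

Lemma lift3_b g : g \in outer_box -> lift3 (mod_b g) = (lift3 g * mkZ 0 1 0)%g.
Proof.
rewrite outer_boxE => /and3P[xn yn zn].
rewrite /lift3 heisZME /=; apply: mkZ_eq; rewrite ?mulr1 ?addr0 //.
  by rewrite -[1 : 'Z_N]/(1%:~R) lift1D //; lift_lia.
have -> : g.1.1 - M%:R = (lift1 g.1.1)%:~R by rewrite /lift1 intrB -!pmulrn natr_Zp.
by rewrite lift1D //; lift_lia.
Qed.

Lemma lift3_c g (k : nat) : g \in inner_box -> (k <= n * n)%N ->
  lift3 (iter k mod_c g) = (lift3 g * mkZ 0 0 k)%g.
Proof.
rewrite inner_boxE => /and3P[xn yn zn] kn.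
rewrite iter_mod_c /lift3 heisZME /=; apply: mkZ_eq; rewrite ?mulr0 ?addr0 //.
by rewrite -[k%:R]/((k%:Z)%:~R) lift1D //; lift_lia.
Qed.

Lemma outer_box_support g : cutoff R n (lift3 g) != 0 -> g \in outer_box.
Proof.
by move=> /(cutoff_neq0 n0)[/= xn yn zn]; rewrite outer_boxE; lift_lia.
Qed.

Lemma outer_box_support_a g : cutoff R n (lift3 (mod_a g)) != 0 -> g \in outer_box.
Proof.
move=> /(cutoff_neq0 n0)[/= xn yn zn]; rewrite outer_boxE.
have -> : lift1 g.1.1 = lift1 (g.1.1 + 1) + -1.
  by rewrite -lift1D ?mulrN1z ?addrK //; lift_lia.
by lift_lia.
Qed.

Lemma outer_box_support_b g : cutoff R n (lift3 (mod_b g)) != 0 -> g \in outer_box.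
Proof.
move=> /(cutoff_neq0 n0)[/= xn yn zn]; rewrite outer_boxE.
have -> : lift1 g.1.2 = lift1 (g.1.2 + 1) + -1.
  by rewrite -lift1D ?mulrN1z ?addrK //; lift_lia.
move: zn; have -> : g.1.1 - M%:R = (lift1 g.1.1)%:~R by rewrite /lift1 intrB -!pmulrn natr_Zp.
set z' := g.2 + _ => zn.
have -> : lift1 g.2 = lift1 z' + - lift1 g.1.1.
  by rewrite -lift1D ?mulrNz ?addrK //; lift_lia.
by lift_lia.
Qed.

(** Leibniz rule for the product of the cutoff, whose gradient is O(1 / n), with
    [phi]. *)
Let step_bound (s : heisZ) (f : G -> G) (phi : heisZ -> R) (v : G -> R) :
  (forall g, v g = cutoff R n (lift3 g) * phi (lift3 g)) ->
  (forall p, `|cutoff R n (p * s)%g - cutoff R n p| <= 3 / n%:R) ->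
  (forall g, g \in outer_box -> lift3 (f g) = (lift3 g * s)%g) ->
  (forall g, cutoff R n (lift3 (f g)) != 0 -> g \in outer_box) ->
  \sum_g (v (f g) - v g) ^+ 2 <= \sum_(g in outer_box)
    (2 * (phi (lift3 g * s)%g - phi (lift3 g)) ^+ 2 +
     18 / (n * n)%:R * phi (lift3 g) ^+ 2).
Proof.
move=> vE lip fE fsupp; rewrite [leRHS]big_mkcond /=; apply: ler_sum => g _.
case: ifPn => [g_in|g_out]; last first.
  have -> : v (f g) = 0.
    by apply/eqP; rewrite vE mulf_eq0; apply/orP; left; apply: contraR g_out => /fsupp.
  have -> : v g = 0.
    apply/eqP; rewrite vE mulf_eq0; apply/orP; left.
    by apply: contraR g_out => /outer_box_support.
  by rewrite subrr expr0n.
rewrite !vE (fE g g_in); move: (lift3 g) => p; set q := (p * s)%g.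
have -> : cutoff R n q * phi q - cutoff R n p * phi p =
  cutoff R n q * (phi q - phi p) + (cutoff R n q - cutoff R n p) * phi p by ring.
have sqr2 (x y : R) : (x + y) ^+ 2 <= 2 * x ^+ 2 + 2 * y ^+ 2.
  by have := sqr_ge0 (x - y); nra.
apply: le_trans (sqr2 _ _) _.
rewrite [(cutoff R n q * _) ^+ 2]exprMn [((cutoff R n q - _) * _) ^+ 2]exprMn.
apply: lerD.
  rewrite ler_pM2l // ler_piMl ?sqr_ge0 //.
  by rewrite exprn_ile1 ?cutoff_ge0 ?cutoff_le1.
rewrite mulrA ler_wpM2r ?sqr_ge0 //.
have -> : 18 / (n * n)%:R = 2 * (3 / n%:R) ^+ 2 :> R.
  by rewrite natrM; field; rewrite pnatr_eq0 -lt0n.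
by rewrite ler_pM2l // -real_normK ?num_real // lerXn2r ?nnegrE ?divr_ge0 ?lip.
Qed.

(** [vertical_horizontal] on the finite quotient for [phi] times the cutoff; on the
    left only the points where the cutoff is 1 before and after the vertical move are
    kept. *)
Lemma box_inequality (phi : heisZ -> R) (J : nat) : (4 ^ J <= n * n)%N ->
  \sum_(j < J) \sum_(g in inner_box)
     (4 ^+ j)^-1 * (phi (lift3 g * mkZ 0 0 (4 ^ j)%N)%g - phi (lift3 g)) ^+ 2 <=
  \sum_(g in outer_box)
    (168 * (phi (lift3 g * mkZ 1 0 0)%g - phi (lift3 g)) ^+ 2 +
     168 * (phi (lift3 g * mkZ 0 1 0)%g - phi (lift3 g)) ^+ 2 +
     3024 / (n * n)%:R * phi (lift3 g) ^+ 2).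
Proof.
move=> Jn; pose v g := cutoff R n (lift3 g) * phi (lift3 g).
have := @vertical_horizontal R G mod_a mod_b mod_c N mod_a_inj mod_b_inj
  (ltnW N1) iter_mod_cN.
have mbc g : mod_b (mod_c g) = mod_c (mod_b g) by rewrite /mod_b /mod_c /= addrAC.
have mba g : mod_b (mod_a g) = mod_c (mod_a (mod_b g)).
  by rewrite /mod_a /mod_b /mod_c /= -!addrA [1 + _]addrC.
move=> /(_ (fun=> erefl) mbc mba v J) vh.
have va := @step_bound _ _ phi v (fun=> erefl) (fun p => cutoff_stepa R p n0)
  lift3_a outer_box_support_a.
have vb := @step_bound _ _ phi v (fun=> erefl) (fun p => cutoff_stepb R p n0)
  lift3_b outer_box_support_b.
apply: (@le_trans _ _ (84 * (\sum_g (v (mod_a g) - v g) ^+ 2 +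
    \sum_g (v (mod_b g) - v g) ^+ 2))); last first.
  apply: le_trans (ler_wpM2l _ (lerD va vb)) _ => //.
  rewrite -big_split mulr_sumr /=; apply: ler_sum => g _.
  by set A := _ ^+ 2; set B := _ ^+ 2; set C := _ ^+ 2; set k := _^-1; lra.
apply: le_trans vh; apply: ler_sum => j _.
rewrite -mulr_sumr mulrC ler_wpM2r ?invr_ge0 ?exprn_ge0 //.
rewrite [leLHS]big_mkcond /=; apply: ler_sum => g _.
case: ifPn => [g_in|_]; last exact: sqr_ge0.
have jn : (4 ^ j <= n * n)%N by apply: leq_trans Jn; rewrite leq_exp2l // ltnW.
rewrite /v lift3_c //; move: (g_in); rewrite inner_boxE => /and3P[xn yn zn].
rewrite heisZME !cutoff_eq1 ?mul1r ?addr0 ?mulr0 //=; lift_lia.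
Qed.

Let card_interval (a b : nat) : (a <= b)%N -> (b <= N)%N ->
  #|[set i : 'Z_N | (a <= i < b)%N]%SET| = (b - a)%N.
Proof.
move=> ab bN; have NE : (Zp_trunc N).+2 = N by apply: Zp_cast.
rewrite -sum1_card big_mkcond /=.
transitivity (\sum_(0 <= i < N) (if (a <= i < b)%N then 1 else 0))%N.
  rewrite -[X in (\sum_(0 <= _ < X) _)%N]NE big_mkord.
  by apply: eq_bigr => i _; rewrite finset.in_set.
rewrite (big_cat_nat (n := b)) //= (big_cat_nat (n := a)) //=.
rewrite [X in (X + _ + _)%N]big_nat_cond big1 => [|i]; last first.
  by rewrite andbT => /andP[_ ia]; rewrite leqNgt ia.
rewrite [X in (_ + X)%N]big_nat_cond [X in (_ + X)%N]big1 => [|i]; last first.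
  by rewrite andbT => /andP[bi _]; rewrite [(i < b)%N]ltnNge bi andbF.
rewrite add0n addn0 big_nat_cond (eq_bigr (fun=> 1%N)) => [|i].
  by rewrite -big_nat_cond sum_nat_const_nat muln1.
by rewrite andbT => ->.
Qed.

Let card_box1 k : (k < M)%N -> #|box1 k| = (k + k).+1.
Proof.
move=> kM; have -> : box1 k = [set i : 'Z_N | (M - k <= i < (M + k).+1)%N]%SET.
  by apply/finset.setP => i; rewrite !finset.in_set /lift1; lia.
by rewrite card_interval /N; lia.
Qed.

Lemma card_inner_box : (n ^ 4 <= #|inner_box|)%N.
Proof.
rewrite !finset.cardsX !card_box1 /M; [|nia..].
have -> : [set i : 'Z_N | - (n * n)%:Z <= lift1 i <= 0]%SET =
    [set i : 'Z_N | (M - n * n <= i < M.+1)%N]%SET.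
  by apply/finset.setP => i; rewrite !finset.in_set /lift1 /M; lia.
rewrite card_interval /N /M; [|nia..].
have -> : (n ^ 4 = n * n * (n * n))%N by rewrite !expnS expn0; lia.
by rewrite leq_mul ?leq_mul //; nia.
Qed.

Lemma card_outer_box : (#|outer_box| <= 225 * n ^ 4)%N.
Proof.
rewrite !finset.cardsX !card_box1 /M; [|nia..].
have -> : (225 * n ^ 4 = 5 * n * (5 * n) * (9 * (n * n)))%N.
  by rewrite !expnS expn0; lia.
by rewrite !leq_mul //; nia.
Qed.

End FiniteModel.

(** * Distances in the Hilbert space as integrals *)

Section L2.
Variable R : realType.
Local Notation mu := (@lebesgue_measure R).
Implicit Types u v w : L2 R.

Lemma L2_measurable u : measurable_fun setT (u : R -> R).
Proof.
rewrite /aqEqMfun_to_fun; set r := repr _.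
exact: (@measurable_funPT _ _ _ _ r).
Qed.

Lemma Lnorm2_sqr (h : R -> R) : measurable_fun setT h ->
  (('N[mu]_(2%:E)[EFin \o h]) `^ 2 = \int[mu]_s ((h s) ^+ 2)%:E)%E.
Proof.
move=> mh; rewrite powR_Lnorm //.
apply: eq_integral => s _ /=; rewrite powR_mulrn //.
by rewrite real_normK // num_real.
Qed.

Lemma L2_normB_lty u v :
  ('N[mu]_(2%:E)[EFin \o ((u : R -> R) \- (v : R -> R))%R] < +oo)%E.
Proof.
have mu_ := L2_measurable u; have mv := L2_measurable v.
have -> : (u : R -> R) \- (v : R -> R) = (u : R -> R) \+ (fun s => - (v : R -> R) s) by [].
apply: le_lt_trans (eminkowski _ _ _ _) _ => //.
- by apply: measurableT_comp.
- by rewrite lee1n.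
- rewrite (_ : EFin \o (fun s => - (v : R -> R) s) = (fun s => - ((EFin \o (v : R -> R)) s))%E) //.
  rewrite oppe_Lnorm lte_add_pinfty //; exact: Lebesgue_finite.
Qed.

Lemma L2dist_ge0 u v : 0 <= L2dist u v.
Proof. by rewrite fine_ge0 // Lnorm_ge0. Qed.

Lemma L2dist_sqr u v :
  (\int[mu]_s ((((u : R -> R) s - (v : R -> R) s) ^+ 2)%R)%:E =
  ((L2dist u v) ^+ 2)%:E)%E.
Proof.
rewrite -(@Lnorm2_sqr ((u : R -> R) \- (v : R -> R))); last first.
  by apply: measurable_funB; exact: L2_measurable.
rewrite /L2dist -[X in (X `^ _)%E]fineK; last first.
  by rewrite ge0_fin_numE ?Lnorm_ge0 // L2_normB_lty.
by rewrite poweR_EFin powR_mulrn // fine_ge0 // Lnorm_ge0.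
Qed.

Lemma L2dist_triangle u v w : L2dist u w <= L2dist u v + L2dist v w.
Proof.
rewrite -lee_fin EFinD /L2dist !fineK ?ge0_fin_numE ?Lnorm_ge0 ?L2_normB_lty //.
have -> : (u : R -> R) \- (w : R -> R) =
    ((u : R -> R) \- (v : R -> R)) \+ ((v : R -> R) \- (w : R -> R)).
  by apply/funext => s /=; rewrite addrA subrK.
apply: eminkowski; rewrite ?lee1n //; apply: measurable_funB; exact: L2_measurable.
Qed.

Lemma L2dist_sym u v : L2dist u v = L2dist v u.
Proof.
rewrite /L2dist -oppe_Lnorm; congr (fine (Lnorm _ _ _)); apply/funext => s /=.
by rewrite opprB.
Qed.

Lemma measurable_sqrB u v :
  measurable_fun setT (fun s => ((u : R -> R) s - (v : R -> R) s) ^+ 2).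
Proof.
by apply: measurable_funX; apply: measurable_funB; exact: L2_measurable.
Qed.

(** Bookkeeping for integrating a pointwise inequality between finite positive
    combinations of squares term by term. *)
Definition integrates (F : R -> R) (V : R) :=
  [/\ measurable_fun setT F, forall s, 0 <= F s
    & (\int[mu]_s (F s)%:E = V%:E)%E].

Lemma integrates_sqrB u v :
  integrates (fun s => ((u : R -> R) s - (v : R -> R) s) ^+ 2) (L2dist u v ^+ 2).
Proof.
split=> [|s|]; [exact: measurable_sqrB|exact: sqr_ge0|].
exact: L2dist_sqr.
Qed.

Lemma integratesZ (a : R) F V : 0 <= a -> integrates F V ->
  integrates (fun s => a * F s) (a * V).
Proof.
move=> a0 [mF F0 FV]; split=> [|s|]; first exact: measurable_funM.
  by rewrite mulr_ge0.
under eq_integral do rewrite EFinM.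
rewrite ge0_integralZl_EFin ?FV //; first by move=> s _; rewrite lee_fin.
exact/measurable_EFinP.
Qed.

Lemma integratesD F V F' V' : integrates F V -> integrates F' V' ->
  integrates (fun s => F s + F' s) (V + V').
Proof.
move=> [mF F0 FV] [mF' F0' FV']; split=> [|s|]; first exact: measurable_funD.
  by rewrite addr_ge0.
under eq_integral do rewrite EFinD.
rewrite ge0_integralD // ?FV ?FV' //.
- by move=> s _; rewrite lee_fin.
- exact/measurable_EFinP.
- by move=> s _; rewrite lee_fin.
- exact/measurable_EFinP.
Qed.

Lemma integrates_sum (I : Type) (r : seq I) (P : pred I) (F : I -> R -> R)
    (V : I -> R) : (forall i, P i -> integrates (F i) (V i)) ->
  integrates (fun s => \sum_(i <- r | P i) F i s) (\sum_(i <- r | P i) V i).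
Proof.
move=> FV; elim: r => [|i r IHr].
  rewrite big_nil; under eq_fun do rewrite big_nil.
  by split=> //; exact: integral0.
rewrite big_cons; under eq_fun do rewrite big_cons.
by case: ifP => // Pi; apply: integratesD => //; exact: FV.
Qed.

Lemma integrates_le F V F' V' : integrates F V -> integrates F' V' ->
  (forall s, F s <= F' s) -> V <= V'.
Proof.
move=> [mF F0 FV] [mF' F0' FV'] leF; rewrite -lee_fin -FV -FV'.
apply: ge0_le_integral => //=.
- by move=> s _; rewrite lee_fin.
- exact/measurable_EFinP.
- exact/measurable_EFinP.
- by move=> s _; rewrite lee_fin.
Qed.

End L2.

(** * Necessity of the integral condition *)

Section CompressionBound.
Variables (R : realType) (f : heisenberg -> L2 R) (L : R).
Hypothesis L0 : 0 <= L.
Hypothesis f_lip : forall x y, L2dist (f x) (f y) <= L * (heis_dW x y)%:R.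

Lemma heis_dW_of p q :
  heis_dW (heis_of p) (heis_of (p * q)%g) = word_length heis_S (heis_of q).
Proof. by rewrite /heis_dW /word_dist heis_ofM mulKg. Qed.

Lemma lip_sqr (k : nat) p q : (word_length heis_S (heis_of q) <= k)%N ->
  L2dist (f (heis_of (p * q)%g)) (f (heis_of p)) ^+ 2 <= (L * k%:R) ^+ 2.
Proof.
move=> qk; rewrite lerXn2r ?nnegrE ?L2dist_ge0 ?mulr_ge0 //.
rewrite L2dist_sym (le_trans (f_lip _ _)) // heis_dW_of ler_wpM2l //.
by rewrite ler_nat.
Qed.

(** [box_inequality] with n = 2^J for the coordinates of f - f(1).  The factor 225
    compares the numbers of points of the two boxes, and 400 = 20^2 because points of
    the outer box have length at most 20 n. *)
Lemma theta_sum_le (theta : R -> R) :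
  (forall t, 0 < t -> 0 <= theta t) ->
  (forall s t, 0 < s -> s <= t -> theta s <= theta t) ->
  (forall x y, x != y -> theta (heis_dW x y)%:R <= L2dist (f x) (f y)) ->
  forall J : nat, \sum_(j < J) theta (2 ^+ j) ^+ 2 / 4 ^+ j <=
    225 * (336 + 3024 * 400) * L ^+ 2.
Proof.
move=> theta0 theta_nd theta_f J; pose n := (2 ^ J)%N.
have n0 : (0 < n)%N by rewrite expn_gt0.
have nn : (4 ^ J = n * n)%N by rewrite /n -expnMn.
pose A := inner_box n; pose B := outer_box n.
pose F (p : heisZ) : L2 R := f (heis_of p).
have box_ineq : \sum_(j < J) \sum_(g in A)
     (4 ^+ j)^-1 * L2dist (F (lift3 g * mkZ 0 0 (4 ^ j)%N)%g) (F (lift3 g)) ^+ 2 <=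
   \sum_(g in B)
    (168 * L2dist (F (lift3 g * mkZ 1 0 0)%g) (F (lift3 g)) ^+ 2 +
     168 * L2dist (F (lift3 g * mkZ 0 1 0)%g) (F (lift3 g)) ^+ 2 +
     3024 / (n * n)%:R * L2dist (F (lift3 g)) (F 1%g) ^+ 2).
  apply: integrates_le.
  - apply: integrates_sum => j _; apply: integrates_sum => g _.
    by apply: integratesZ; [rewrite invr_ge0 exprn_ge0|exact: integrates_sqrB].
  - apply: integrates_sum => g _; apply: integratesD; first apply: integratesD.
    + by apply: integratesZ; [exact: ler0n|exact: integrates_sqrB].
    + by apply: integratesZ; [exact: ler0n|exact: integrates_sqrB].
    + by apply: integratesZ; [exact: divr_ge0 (ler0n _ _) (ler0n _ _)|exact: integrates_sqrB].
  - move=> s; have := @box_inequality R n n0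
      (fun p => (F p : R -> R) s - (F 1%g : R -> R) s) J.
    rewrite nn leqnn => /(_ isT); rewrite -/A -/B.
    have subB (x y c : R) : (x - c) - (y - c) = x - y by ring.
    under eq_bigr do under eq_bigr do rewrite subB.
    by under [X in _ <= X -> _]eq_bigr do rewrite !subB.
have upper : \sum_(g in B)
    (168 * L2dist (F (lift3 g * mkZ 1 0 0)%g) (F (lift3 g)) ^+ 2 +
     168 * L2dist (F (lift3 g * mkZ 0 1 0)%g) (F (lift3 g)) ^+ 2 +
     3024 / (n * n)%:R * L2dist (F (lift3 g)) (F 1%g) ^+ 2) <=
   #|B|%:R * ((336 + 3024 * 400) * L ^+ 2).
  rewrite [leRHS]mulr_natl -[leRHS]sumr_const; apply: ler_sum => g gB.
  have ga : L2dist (F (lift3 g * mkZ 1 0 0)%g) (F (lift3 g)) ^+ 2 <= (L * 1%:R) ^+ 2.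
    by apply: lip_sqr; exact: word_length_x.
  have gb : L2dist (F (lift3 g * mkZ 0 1 0)%g) (F (lift3 g)) ^+ 2 <= (L * 1%:R) ^+ 2.
    by apply: lip_sqr; exact: word_length_y.
  have gp : L2dist (F (lift3 g)) (F 1%g) ^+ 2 <= (L * (20 * n)%:R) ^+ 2.
    rewrite -{1}[lift3 g]mul1g; apply: lip_sqr.
    move: gB; rewrite /B outer_boxE => /and3P[xn yn zn].
    have -> : (20 * n = 10 * (2 * n))%N by rewrite mulnA.
    apply: word_length_box => //; first by rewrite muln_gt0.
    by apply: leq_trans zn _; rewrite mulnACA.
  have -> : (336 + 3024 * 400) * L ^+ 2 = 168 * (L * 1%:R) ^+ 2 +
      168 * (L * 1%:R) ^+ 2 + 3024 / (n * n)%:R * (L * (20 * n)%:R) ^+ 2.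
    by rewrite !natrM; field; rewrite pnatr_eq0 -lt0n.
  apply: lerD; first apply: lerD.
  - by apply: ler_wpM2l; [exact: ler0n|exact: ga].
  - by apply: ler_wpM2l; [exact: ler0n|exact: gb].
  - apply: ler_wpM2l; last exact: gp.
    exact: divr_ge0 (ler0n _ _) (ler0n _ _).
have lower : #|A|%:R * \sum_(j < J) theta (2 ^+ j) ^+ 2 / 4 ^+ j <=
    \sum_(j < J) \sum_(g in A)
     (4 ^+ j)^-1 * L2dist (F (lift3 g * mkZ 0 0 (4 ^ j)%N)%g) (F (lift3 g)) ^+ 2.
  rewrite mulr_sumr; apply: ler_sum => j _.
  rewrite [leLHS]mulr_natl -[leLHS]sumr_const; apply: ler_sum => g _.
  rewrite mulrC ler_wpM2l ?invr_ge0 ?exprn_ge0 //.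
  have th0 : 0 <= theta (2 ^+ j) by rewrite theta0 // exprn_gt0.
  rewrite lerXn2r ?nnegrE ?L2dist_ge0 // L2dist_sym.
  set q := mkZ 0 0 _.
  have q_len : (2 ^ j <= word_length heis_S (heis_of q))%N.
    have [_ _] := coord_le_length (heis_of q); rewrite heis_ofK /= => le_q.
    by rewrite -leq_sqr -expnM mulnC expnM -[X in (_ <= X)%N]mulnn.
  apply: le_trans (theta_f _ _ _); last first.
    rewrite (inj_eq (can_inj heis_ofK)) -[X in X != _]mulg1 (inj_eq (mulgI _)).
    rewrite heisZ1E /q; apply/eqP => -[] /eqP.
    by rewrite eq_sym expn_eq0.
  rewrite heis_dW_of; apply: theta_nd; first by rewrite exprn_gt0.
  by rewrite -natrX ler_nat.
have cA := card_inner_box n0; have cB := card_outer_box n0.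
have n4 : 0 < (n ^ 4)%:R :> R by rewrite ltr0n expn_gt0 n0.
rewrite -(ler_pM2l n4); set S := \sum_(j < J) theta (2 ^+ j) ^+ 2 / 4 ^+ j in lower *.
have S0 : 0 <= S.
  by rewrite sumr_ge0 // => j _; rewrite divr_ge0 ?sqr_ge0 ?exprn_ge0.
apply: (@le_trans _ _ (#|A|%:R * S)); first by rewrite ler_wpM2r // ler_nat.
apply: le_trans lower _; apply: le_trans box_ineq _; apply: le_trans upper _.
set K := 336 + _; have K0 : 0 <= K * L ^+ 2.
  by apply: mulr_ge0 (sqr_ge0 _); rewrite /K; lra.
apply: (@le_trans _ _ ((225 * n ^ 4)%:R * (K * L ^+ 2))).
  by rewrite ler_wpM2r // ler_nat.
by rewrite natrM; lra.
Qed.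

End CompressionBound.

(** * The integral condition and dyadic sums *)

Section DyadicIntegral.
Variables (R : realType) (theta : R -> R).
Hypothesis theta_ge0 : forall t, 0 < t -> 0 <= theta t.
Hypothesis theta_nd : forall s t, 0 < s -> s <= t -> theta s <= theta t.
Local Notation mu := (@lebesgue_measure R).

Let weight (t : R) : R := (theta t / t) ^+ 2 / t.

Let dyadic (j : nat) : set R := `[2 ^+ j, 2 ^+ j.+1[%classic.

Lemma bigcup_dyadic : \bigcup_j dyadic j = (`[1%R, +oo[%classic : set R).
Proof.
apply/seteqP; split=> t /=.
  move=> [j _]; rewrite /dyadic /= !in_itv /= andbT => /andP[jt _].
  by apply: le_trans jt; rewrite exprn_ege1 // ler1n.
rewrite in_itv /= andbT => t1.
have exj : exists j, t < 2 ^+ j by exists (Num.bound t); exact: upper_nthrootP.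
case: (ex_minnP exj) => -[|j] tj jmin; first by move: tj; rewrite expr0 ltNge t1.
exists j => //; rewrite /dyadic /= in_itv /= tj andbT leNgt; apply/negP => /jmin.
by rewrite ltnn.
Qed.

Lemma trivIset_dyadic : trivIset setT dyadic.
Proof.
have mono (i j : nat) (t : R) : dyadic i t -> dyadic j t -> (i <= j)%N.
  rewrite /dyadic /= !in_itv /= => /andP[it _] /andP[_ tj].
  by have := le_lt_trans it tj; rewrite ltr_eXn2l ?ltr1n.
move=> i j _ _ [t [ti tj]]; apply/eqP.
by rewrite eqn_leq (mono _ _ _ ti tj) (mono _ _ _ tj ti).
Qed.

Lemma measure_dyadic j : mu (dyadic j) = (2 ^+ j)%:E.
Proof.
rewrite lebesgue_measure_itv /= lte_fin ltr_eXn2l ?ltr1n // ltnSn.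
by rewrite -EFinB exprS; congr (_%:E); ring.
Qed.

Lemma weight_measurable : measurable_fun (`[1%R, +oo[%classic : set R) weight.
Proof.
(* truncating at 1 makes the functions involved monotone on the whole line *)
pose m (t : R) := Num.max t 1.
have m_gt0 t : 0 < m t by rewrite lt_max ltr01 orbT.
have m_nd s t : s <= t -> m s <= m t.
  by move=> st; rewrite /m ge_max !le_max st lexx orbT.
apply: (eq_measurable_fun (fun t => theta (m t) ^+ 2 * (m t)^-1 ^+ 3)) => [t|].
  rewrite inE /= in_itv /= andbT => t1; rewrite /m (max_idPl t1) /weight.
  by field; rewrite gt_eqF // (lt_le_trans ltr01).
apply: measurable_funM; apply: measurable_funX.
  by apply: nondecreasing_measurable => // s t /m_nd; exact: theta_nd.
apply: nonincreasing_measurable => // s t /m_nd st.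
by rewrite lef_pV2 ?posrE.
Qed.

Lemma weight_ge0 t : 0 < t -> 0 <= weight t.
Proof. by move=> t0; rewrite divr_ge0 ?sqr_ge0 ?ltW. Qed.

Lemma dyadic_gt0 j t : dyadic j t -> 0 < t.
Proof. by rewrite /dyadic /= in_itv /= => /andP[jt _]; exact: lt_le_trans jt. Qed.

Lemma measurable_dyadic j : measurable_fun (dyadic j) (EFin \o weight).
Proof.
have sub : dyadic j `<=` `[1, +oo[%classic.
  by rewrite -bigcup_dyadic => t jt; exists j.
apply: (measurable_funS _ sub) => //.
apply/measurable_EFinP; exact: weight_measurable.
Qed.

Lemma weight_le j t : dyadic j t ->
  theta (2 ^+ j) ^+ 2 / (2 ^+ j.+1) ^+ 3 <= weight t <=
  theta (2 ^+ j.+1) ^+ 2 / (2 ^+ j) ^+ 3.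
Proof.
move=> jt; have t0 := dyadic_gt0 jt.
move: jt; rewrite /dyadic /= in_itv /= => /andP[jt tj].
have -> : weight t = theta t ^+ 2 / t ^+ 3.
  by rewrite /weight; field; rewrite gt_eqF.
have sqr_nd (s s' : R) : 0 < s -> s <= s' -> theta s ^+ 2 <= theta s' ^+ 2.
  move=> s0 ss; have := theta_nd s0 ss; have := theta_ge0 s0; nra.
have inv_ni (s s' : R) : 0 < s -> s <= s' -> (s' ^+ 3)^-1 <= (s ^+ 3)^-1.
  move=> s0 ss; have s'0 := lt_le_trans s0 ss.
  rewrite lef_pV2 ?posrE ?exprn_gt0 //.
  by rewrite lerXn2r ?nnegrE ?(ltW s0) ?(ltW s'0).
apply/andP; split; apply: ler_pM; rewrite ?sqr_ge0 ?invr_ge0 ?exprn_ge0 ?(ltW t0) //.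
- exact: sqr_nd.
- exact: inv_ni (ltW tj).
- exact: sqr_nd (ltW tj).
- exact: inv_ni.
Qed.

Lemma integral_dyadic j :
  ((theta (2 ^+ j) ^+ 2 / 4 ^+ j / 8)%:E <= \int[mu]_(t in dyadic j) (weight t)%:E)%E /\
  (\int[mu]_(t in dyadic j) (weight t)%:E <= (4 * (theta (2 ^+ j.+1) ^+ 2 / 4 ^+ j.+1))%:E)%E.
Proof.
have mD : measurable (dyadic j) by exact: measurable_itv.
have E (c : R) : (\int[mu]_(t in dyadic j) (cst c%:E) t = (c * 2 ^+ j)%:E)%E.
  by rewrite integral_cst // EFinM -measure_dyadic.
have X4 : (4 : R) ^+ j = 2 ^+ j * 2 ^+ j.
  by rewrite -exprMn; congr (_ ^+ _); lra.
have Xn0 : (2 : R) ^+ j != 0 by rewrite gt_eqF.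
split.
  have -> : theta (2 ^+ j) ^+ 2 / 4 ^+ j / 8 =
      theta (2 ^+ j) ^+ 2 / (2 ^+ j.+1) ^+ 3 * 2 ^+ j.
    by rewrite X4 [2 ^+ j.+1]exprS; field.
  rewrite -E; apply: ge0_le_integral => //=.
  - by move=> t _; rewrite lee_fin divr_ge0 ?sqr_ge0 ?exprn_ge0.
  - exact: measurable_dyadic.
  - by move=> t /weight_le/andP[]; rewrite lee_fin.
have -> : 4 * (theta (2 ^+ j.+1) ^+ 2 / 4 ^+ j.+1) =
    theta (2 ^+ j.+1) ^+ 2 / (2 ^+ j) ^+ 3 * 2 ^+ j.
  by rewrite [4 ^+ j.+1]exprS X4; field.
rewrite -E; apply: ge0_le_integral => //=.
- by move=> t jt; rewrite lee_fin weight_ge0 // (dyadic_gt0 jt).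
- exact: measurable_dyadic.
- by move=> t /weight_le/andP[]; rewrite lee_fin.
Qed.

Lemma integral_weight : (\int[mu]_(t in `[1%R, +oo[) (weight t)%:E =
  \sum_(j <oo) \int[mu]_(t in dyadic j) (weight t)%:E)%E.
Proof.
rewrite -bigcup_dyadic ge0_integral_bigcup //.
- by move=> j; exact: measurable_itv.
- by rewrite bigcup_dyadic; apply/measurable_EFinP; exact: weight_measurable.
- by move=> t [j _ /dyadic_gt0 t0]; rewrite lee_fin weight_ge0.
- exact: trivIset_dyadic.
Qed.

Lemma integral_dyadic_ge0 j : (0 <= \int[mu]_(t in dyadic j) (weight t)%:E)%E.
Proof.
by apply: integral_ge0 => t /dyadic_gt0 t0; rewrite lee_fin weight_ge0.
Qed.

Lemma dyadic_sum_of_integral :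
  (\int[mu]_(t in `[1%R, +oo[) (weight t)%:E < +oo)%E ->
  exists2 B : R, 0 <= B &
    forall J : nat, \sum_(j < J) theta (2 ^+ j) ^+ 2 / 4 ^+ j <= B.
Proof.
set I := integral _ _ _ => I_lty.
have I0 : (0 <= I)%E.
  by apply: integral_ge0 => t /=; rewrite in_itv /= andbT => t1;
     rewrite lee_fin weight_ge0 // (lt_le_trans ltr01).
exists (8 * fine I) => [|J]; first by rewrite mulr_ge0 ?fine_ge0.
rewrite mulrC -ler_pdivrMr // -lee_fin fineK ?ge0_fin_numE // mulr_suml -sumEFin.
rewrite /I integral_weight.
apply: le_trans (nneseries_lim_ge J (fun j _ _ => integral_dyadic_ge0 j)).
rewrite -(big_mkord xpredT (fun j => (theta (2 ^+ j) ^+ 2 / 4 ^+ j / 8)%:E)).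
by apply: lee_sum => j _; exact: (integral_dyadic j).1.
Qed.

Lemma integral_of_dyadic_sum (B : R) :
  (forall J : nat, \sum_(j < J) theta (2 ^+ j) ^+ 2 / 4 ^+ j <= B) ->
  (\int[mu]_(t in `[1%R, +oo[) (weight t)%:E < +oo)%E.
Proof.
move=> leB; rewrite integral_weight; apply: (@le_lt_trans _ _ (4 * B)%:E); last exact: ltry.
apply: lime_le; first by apply: is_cvg_nneseries => j _ _; exact: integral_dyadic_ge0.
apply: nearW => J.
apply: (@le_trans _ _ (\sum_(0 <= j < J) (4 * (theta (2 ^+ j.+1) ^+ 2 / 4 ^+ j.+1))%:E)%E).
  by apply: lee_sum => j _; exact: (integral_dyadic j).2.
rewrite big_mkord sumEFin lee_fin -mulr_sumr ler_pM2l //.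
apply: le_trans (leB J.+1); rewrite big_ord_recl lerDr.
by rewrite divr_ge0 ?sqr_ge0 ?exprn_ge0.
Qed.

End DyadicIntegral.

(** * Square-summable families as elements of the Hilbert space *)

Section StepFunctions.
Variables (R : realType) (T : countType).
Local Notation mu := (@lebesgue_measure R).
Implicit Types u v : T -> R.

Definition unit_cell (m : nat) : set R := `[m%:R, m.+1%:R[%classic.

(** With [pickle_inv] instead of [unpickle], each index is the value of a single
    code and the other codes contribute 0. *)
Definition coef u (m : nat) : R := oapp u 0 (pickle_inv m).

Definition step u (s : R) : R := if 0 <= s then coef u (Num.truncn s) else 0.

Lemma step_cell u m s : unit_cell m s -> step u s = coef u m.
Proof.
rewrite /unit_cell /= in_itv /= => ms; have s0 : 0 <= s.
  by case/andP: ms => ms _; apply: le_trans ms.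
by rewrite /step s0 (truncn_def ms).
Qed.

Lemma bigcup_unit_cell : \bigcup_m unit_cell m = (`[0%R, +oo[%classic : set R).
Proof.
apply/seteqP; split=> s /=.
  move=> [m _]; rewrite /unit_cell /= !in_itv /= andbT => /andP[ms _].
  exact: le_trans ms.
rewrite in_itv /= andbT => s0; exists (Num.truncn s) => //.
by rewrite /unit_cell /= in_itv /= truncn_itv.
Qed.

Lemma trivIset_unit_cell : trivIset setT unit_cell.
Proof.
have mono (i j : nat) (t : R) : unit_cell i t -> unit_cell j t -> (i <= j)%N.
  rewrite /unit_cell /= !in_itv /= => /andP[it _] /andP[_ tj].
  by have := le_lt_trans it tj; rewrite ltr_nat.
move=> i j _ _ [t [ti tj]]; apply/eqP.
by rewrite eqn_leq (mono _ _ _ ti tj) (mono _ _ _ tj ti).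
Qed.

Lemma measurable_step u : measurable_fun setT (step u).
Proof.
have -> : [set: R] = `]-oo, 0%R[%classic `|` \bigcup_m unit_cell m.
  rewrite bigcup_unit_cell; apply/seteqP; split=> // s _ /=.
  by rewrite !in_itv /= andbT; have [] := ltP s 0; [left|right].
apply/measurable_funU; [exact: measurable_itv|..].
  by apply: bigcup_measurable => m _; exact: measurable_itv.
split.
  apply: (@eq_measurable_fun _ _ _ _ _ (cst (0 : R))) => [s|]; last exact: measurable_cst.
  by rewrite inE /= in_itv /= /step => s0; rewrite leNgt s0.
apply/measurable_fun_bigcup => m; first exact: measurable_itv.
apply: (@eq_measurable_fun _ _ _ _ _ (cst (coef u m))) => [s|]; last exact: measurable_cst.
by rewrite inE => /step_cell ->.
Qed.

Lemma measure_unit_cell m : mu (unit_cell m) = 1%:E.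
Proof.
rewrite lebesgue_measure_itv /= lte_fin ltr_nat ltnSn -EFinB.
by rewrite -natrB // subSnn.
Qed.

Lemma esum_coef u : (\esum_(m in [set: nat]) ((coef u m) ^+ 2)%:E =
  \esum_(i in [set: T]) ((u i) ^+ 2)%:E)%E.
Proof.
transitivity (\esum_(m in pickle @` [set: T]) ((coef u m) ^+ 2)%:E)%E; last first.
  rewrite esum_image; first by apply: eq_esum => i _; rewrite /coef pickleK_inv.
  by move=> i j _ _; exact: (pcan_inj pickleK).
rewrite [RHS]esum_mkcond; apply: eq_esum => m _; case: ifPn => //.
rewrite /coef; have := @pickle_invK T m; case: (pickle_inv m) => [i /= <-|_ _] /=.
  by move=> /negP; case; rewrite in_setE; exists i.
by rewrite expr0n.
Qed.

Lemma integral_step u :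
  (\int[mu]_s ((step u s) ^+ 2)%:E = \esum_(i in [set: T]) ((u i) ^+ 2)%:E)%E.
Proof.
have mf : measurable_fun setT (fun s => ((step u s) ^+ 2)%:E).
  by apply/measurable_EFinP; apply: measurable_funX; exact: measurable_step.
have -> : (\int[mu]_s ((step u s) ^+ 2)%:E =
    \int[mu]_(s in \bigcup_m unit_cell m) ((step u s) ^+ 2)%:E)%E.
  rewrite [RHS]integral_mkcond; apply: eq_integral => s _; rewrite patchE.
  case: ifPn => //; rewrite bigcup_unit_cell => /negP s0.
  rewrite /step; case: ifPn => [s_ge0|_]; last by rewrite expr0n.
  by case: s0; rewrite in_setE /= in_itv /= s_ge0.
rewrite ge0_integral_bigcup.
- rewrite -esum_coef -nneseries_esumT; last by move=> m; rewrite lee_fin sqr_ge0.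
  apply: eq_eseriesr => m _.
  rewrite (eq_integral (cst ((coef u m) ^+ 2)%:E)) => [|s]; last first.
    by rewrite inE => /step_cell ->.
  rewrite integral_cst; last exact: measurable_itv.
  by rewrite -[RHS]mule1 -(measure_unit_cell m).
- by move=> m; exact: measurable_itv.
- exact: measurable_funTS.
- by move=> s _; rewrite lee_fin sqr_ge0.
- exact: trivIset_unit_cell.
Qed.

End StepFunctions.

Section L2Families.
Variable R : realType.
Local Notation mu := (@lebesgue_measure R).

Lemma L2_of_fun (g : R -> R) : measurable_fun setT g ->
  (\int[mu]_s ((g s) ^+ 2)%:E < +oo)%E ->
  exists U : L2 R, ae_eq mu setT (U : R -> R) g.
Proof.
move=> mg g2.
pose G : {mfun measurableTypeR R >-> measurableTypeR R} :=
  HB.pack (g : measurableTypeR R -> measurableTypeR R)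
    (@isMeasurableFun.Build _ _ (measurableTypeR R) (measurableTypeR R) g mg).
pose q : {mfun_ mu, measurableTypeR R >-> measurableTypeR R} := (\pi G)%qT.
have qG : ae_eq mu setT (q : R -> R) g.
  have /eqmodP/asboolP : (repr q = G %[mod {mfun_ mu, measurableTypeR R >-> measurableTypeR R}])%qT.
    by rewrite reprK.
  by apply: filterS => s /= + _; apply.
have mq : measurable_fun setT (q : R -> R).
  rewrite /aqEqMfun_to_fun; set r := repr _.
  exact: (@measurable_funPT _ _ _ _ r).
have qfin : finite_norm mu 2%:E (q : R -> R).
  apply: (@lty_poweRy _ _ 2) => //; rewrite Lnorm2_sqr //.
  apply: le_lt_trans g2; rewrite le_eqVlt; apply/orP; left; apply/eqP.
  apply: ae_eq_integral => //.
  - by apply/measurable_EFinP; exact: measurable_funX.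
  - by apply/measurable_EFinP; exact: measurable_funX.
  - by apply: filterS qG => s /= qg _; rewrite qg.
pose U : L2 R := HB.pack q (@isFinLebesgue.Build _ _ R mu 2%:E (lee1n 2) q qfin).
by exists U.
Qed.

(** Families indexed by a countable type are realised as step functions, which
    turns the norm of a difference into a sum of squares. *)
Lemma L2_of_family (T : countType) (I : Type) (u : I -> T -> R) :
  (forall i, \esum_(t in [set: T]) ((u i t) ^+ 2)%:E < +oo)%E ->
  exists f : I -> L2 R, forall i j, ((L2dist (f i) (f j) ^+ 2)%:E =
    \esum_(t in [set: T]) ((u i t - u j t) ^+ 2)%:E)%E.
Proof.
move=> ufin.
have exf i : exists U : L2 R, ae_eq mu setT (U : R -> R) (step (u i)).
  apply: L2_of_fun; first exact: measurable_step.
  by rewrite integral_step.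
have [f fE] := choice exf; exists f => i j.
rewrite -L2dist_sqr -(@integral_step _ _ (fun t => u i t - u j t)).
have stepB s : step (fun t => u i t - u j t) s = step (u i) s - step (u j) s.
  rewrite /step; case: ifP => _; last by rewrite subrr.
  by rewrite /coef; case: (pickle_inv _) => [t|] //=; rewrite subrr.
apply: ae_eq_integral => //.
- by apply/measurable_EFinP; exact: measurable_sqrB.
- by apply/measurable_EFinP; apply: measurable_funX; exact: measurable_step.
- apply: filterS2 (fE i) (fE j) => s /= fi fj _.
  by rewrite stepB fi // fj.
Qed.

End L2Families.

(** * Sums over the group of functions supported in a box *)

Section FiniteSupport.
Variable R : realType.

Lemma esum_fin (I : finType) (a : I -> \bar R) : (forall i, 0 <= a i)%E ->
  (\esum_(i in [set: I]) a i = \sum_(i : I) a i)%E.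
Proof.
move=> a0; rewrite esum_fset; [|exact: finite_finset|by move=> i _; exact: a0].
rewrite [RHS]fsbig_seq ?index_enum_uniq //; apply: eq_fsbigl.
by apply/seteqP; split=> // i _ /=; rewrite mem_index_enum.
Qed.

Lemma esumS (T : choiceType) (P : set T) (a : T -> \bar R) :
  (forall t, 0 <= a t)%E -> (\esum_(t in P) a t <= \esum_(t in [set: T]) a t)%E.
Proof.
by move=> a0; rewrite esum_mkcond; apply: le_esum => t _; case: ifP.
Qed.

Lemma esum_range (I : finType) (T : choiceType) (e : I -> T) (a : T -> \bar R) :
  injective e -> (forall t, 0 <= a t)%E ->
  (\esum_(t in range e) a t = \sum_(i : I) a (e i))%E.
Proof.
move=> e_inj a0; rewrite esum_image; first by apply: esum_fin => i; exact: a0.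
by move=> i j _ _; exact: e_inj.
Qed.

Lemma sum_le_esum (I : finType) (T : choiceType) (e : I -> T) (a : T -> \bar R) :
  injective e -> (forall t, 0 <= a t)%E ->
  (\sum_(i : I) a (e i) <= \esum_(t in [set: T]) a t)%E.
Proof.
move=> e_inj a0; apply: le_trans (esumS (range e) a0).
by rewrite esum_range.
Qed.

Lemma esum_le_sum (I : finType) (T : choiceType) (e : I -> T) (a : T -> \bar R) :
  injective e -> (forall t, 0 <= a t)%E -> (forall t, a t != 0%E -> range e t) ->
  (\esum_(t in [set: T]) a t <= \sum_(i : I) a (e i))%E.
Proof.
move=> e_inj a0 a_supp.
rewrite -esum_range // [leRHS]esum_mkcond; apply: le_esum => t _; case: ifPn => // /negP t_out.
have [->//|/a_supp te] := eqVneq (a t) 0%E.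
by case: t_out; rewrite in_setE.
Qed.

Lemma esum_heisZ_mulr (q : heisZ) (a : heisZ -> \bar R) :
  (\esum_(h in [set: heisZ]) a (h * q)%g = \esum_(h in [set: heisZ]) a h)%E.
Proof.
rewrite -(@reindex_esum _ _ _ setT setT (fun h : heisZ => (h * q)%g)) //.
split=> // [h k _ _ /mulIg //|h _ /=].
by exists (h * q^-1)%g => //; rewrite mulgVK.
Qed.

End FiniteSupport.

Section CutoffSums.
Variables (R : realType) (n : nat).
Hypothesis n0 : (0 < n)%N.
Local Notation chi := (cutoff R n).

Let corner (c d : nat) (i : 'I_(2 * c) * 'I_(2 * c) * 'I_(2 * d)) : heisZ :=
  mkZ ((i.1.1 : nat)%:Z - c%:Z) ((i.1.2 : nat)%:Z - c%:Z) ((i.2 : nat)%:Z - d%:Z).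

Let corner_inj c d : injective (@corner c d).
Proof.
move=> [[i j] k] [[i' j'] k'] [] /addIr[ii] /addIr[jj] /addIr[kk].
by congr (_, _, _); apply: val_inj.
Qed.

Definition octant (i : 'I_n * 'I_n * 'I_(n * n)) : heisZ :=
  mkZ (i.1.1 : nat)%:Z (i.1.2 : nat)%:Z (i.2 : nat)%:Z.

Lemma octant_inj : injective octant.
Proof.
move=> [[i j] k] [[i' j'] k'] [] ii jj kk.
by congr (_, _, _); apply: val_inj.
Qed.

Lemma sum_octant : \sum_(i : 'I_n * 'I_n * 'I_(n * n)) chi (octant i) ^+ 2 = (n ^ 4)%:R.
Proof.
rewrite (eq_bigr (fun=> 1)) => [|[[i j] k] _]; last first.
  by rewrite cutoff_eq1 ?expr1n //= ltnW.
rewrite sumr_const !card_prod !card_ord; congr _%:R.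
by rewrite !expnS expn0; lia.
Qed.

Lemma cutoff_support_sum (c : R) : 0 <= c ->
  (\esum_(h in [set: heisZ]) (if chi h != 0 then c else 0)%:E <=
   (c * (64 * n ^ 4)%:R)%:E)%E.
Proof.
move=> c0; apply: le_trans (@esum_le_sum _ _ _ (@corner (2 * n) (2 * (n * n))) _ _ _ _) _.
- exact: corner_inj.
- by move=> h; case: ifP.
- move=> h; case: ifPn => [h_supp _|_]; last by rewrite eqxx.
  have [xn yn zn] := cutoff_neq0 n0 h_supp.
  move: xn yn zn; elim/mkZP: h {h_supp} => x y z /= xn yn zn.
  have xi : (`|(x + (2 * n)%N%:Z)%R| < 2 * (2 * n))%N by lia.
  have yi : (`|(y + (2 * n)%N%:Z)%R| < 2 * (2 * n))%N by lia.
  have zi : (`|(z + (2 * (n * n))%N%:Z)%R| < 2 * (2 * (n * n)))%N by lia.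
  exists (Ordinal xi, Ordinal yi, Ordinal zi) => //.
  by apply: mkZ_eq => /=; lia.
rewrite sumEFin lee_fin; apply: (@le_trans _ _
  (\sum_(i : 'I_(2 * (2 * n)) * 'I_(2 * (2 * n)) * 'I_(2 * (2 * (n * n)))) c)).
  by apply: ler_sum => i _; case: ifP.
rewrite sumr_const !card_prod !card_ord -[leLHS]mulr_natr ler_wpM2l // ler_nat.
by rewrite !expnS expn0; lia.
Qed.

(** The gradient is of order 1 / n and vanishes unless one of its two points lies in
    the support, which has O(n^4) points. *)
Lemma cutoff_energy (s : heisZ) (A : R) : s = mkZ 1 0 0 \/ s = mkZ 0 1 0 ->
  0 <= A ->
  (\esum_(h in [set: heisZ]) (A * (chi (h * s)%g - chi h) ^+ 2)%:E <=
   (A * (1152 * n ^ 2)%:R)%:E)%E.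
Proof.
move=> s_gen A0.
have step h : `|chi (h * s)%g - chi h| <= 3 / n%:R.
  by case: s_gen => ->; [exact: cutoff_stepa|exact: cutoff_stepb].
pose c : R := A * (3 / n%:R) ^+ 2.
have c0 : 0 <= c by rewrite mulr_ge0 ?sqr_ge0.
pose ind (h : heisZ) : R := if chi h != 0 then c else 0.
have ind0 h : 0 <= ind h by rewrite /ind; case: ifP.
have bound h : A * (chi (h * s)%g - chi h) ^+ 2 <= ind (h * s)%g + ind h.
  have sq : A * (chi (h * s)%g - chi h) ^+ 2 <= c.
    by rewrite ler_wpM2l // -real_normK ?num_real // lerXn2r ?nnegrE ?divr_ge0 ?step.
  have i1 := ind0 (h * s)%g; have i2 := ind0 h.
  rewrite {1}/ind; case: ifPn => [_|/negPn/eqP hs0]; first by lra.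
  rewrite {1}/ind; case: ifPn => [_|/negPn/eqP h00]; first by lra.
  by rewrite hs0 h00 subrr expr0n /= mulr0 addr0.
apply: (@le_trans _ _ (\esum_(h in [set: heisZ]) ((ind (h * s)%g)%:E + (ind h)%:E))%E).
  by apply: le_esum => h _; rewrite -EFinD lee_fin.
rewrite esumD; [|by move=> h _; rewrite lee_fin ind0..].
rewrite (esum_heisZ_mulr s (fun h => (ind h)%:E)).
apply: le_trans (leeD (cutoff_support_sum c0) (cutoff_support_sum c0)) _.
rewrite -EFinD lee_fin /c !natrM le_eqVlt; apply/orP; left; apply/eqP.
by field; rewrite pnatr_eq0 -lt0n.
Qed.

End CutoffSums.

(** * Sufficiency of the integral condition *)

Section Construction.
Variables (R : realType) (theta : R -> R).
Hypothesis theta_ge0 : forall t, 0 < t -> 0 <= theta t.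
Hypothesis theta_nd : forall s t, 0 < s -> s <= t -> theta s <= theta t.
Variable B : R.
Hypothesis theta_B :
  forall J : nat, \sum_(j < J) theta (2 ^+ j) ^+ 2 / 4 ^+ j <= B.

(** The functions whose orbit maps are added up.  Index 0 detects the elements of
    length less than 64, which are shorter than the scales of the other indices. *)
Definition bump (k : nat) (h : heisZ) : R :=
  if k is k'.+1 then theta (2 ^+ (k' + 7)) / 4 ^+ k' * cutoff R (2 ^ k') h
  else if h == 1%g then theta (2 ^+ 6) else 0.

Definition energy (q : heisZ) : \bar R :=
  (\esum_(t in [set: nat * heisZ])
     ((bump t.1 (t.2 * q)%g - bump t.1 t.2) ^+ 2)%:E)%E.

Lemma esum_pair_mulr (q : heisZ) (a : nat * heisZ -> \bar R) :
  (\esum_(t in [set: nat * heisZ]) a (t.1, t.2 * q)%g =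
   \esum_(t in [set: nat * heisZ]) a t)%E.
Proof.
rewrite -(@reindex_esum _ _ _ setT setT
  (fun t : nat * heisZ => (t.1, (t.2 * q)%g))) //.
split=> // [[k h] [k' h'] _ _ E|[k h] _ /=].
  have -> : k = k' := congr1 fst E.
  by have /mulIg -> : (h * q)%g = (h' * q)%g := congr1 snd E.
by exists (k, h * q^-1)%g => //; rewrite mulgVK.
Qed.

Lemma energyE x y : (\esum_(t in [set: nat * heisZ])
    ((bump t.1 (t.2 * x)%g - bump t.1 (t.2 * y)%g) ^+ 2)%:E =
  energy (x^-1 * y)%g)%E.
Proof.
rewrite -(esum_pair_mulr (x^-1)%g); apply: eq_esum => -[k h] _ /=.
by rewrite mulgVK -mulgA -sqrrN opprB.
Qed.

Lemma energy1 : energy 1%g = 0%E.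
Proof. by apply: esum1 => t _; rewrite mulg1 subrr expr0n. Qed.

Lemma energyV q : energy q^-1%g = energy q.
Proof.
rewrite -[q^-1%g]mulg1 -energyE; apply: eq_esum => -[k h] _ /=.
by rewrite mulg1.
Qed.

Lemma energyM p q : (energy (p * q)%g <= energy q + energy q + (energy p + energy p))%E.
Proof.
have -> : energy q = (\esum_(t in [set: nat * heisZ])
    ((bump t.1 (t.2 * (p * q))%g - bump t.1 (t.2 * p)%g) ^+ 2)%:E)%E.
  by rewrite energyE invgM mulgVK energyV.
rewrite -!esumD; try by move=> t _; rewrite ?adde_ge0 ?lee_fin ?sqr_ge0.
apply: le_esum => -[k h] _ /=; rewrite -!EFinD lee_fin.
set a := bump _ _; set b := bump k (h * p)%g; set c := bump _ _.
by have := sqr_ge0 ((a - b) - (b - c)); nra.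
Qed.

(** At scale 2^k the energy is theta(2^(k+7))^2 / 4^k up to a constant, and these are
    terms of the dyadic sums, shifted by 7. *)
Lemma energy_gen s : s = mkZ 1 0 0 \/ s = mkZ 0 1 0 ->
  (energy s <= (2 * theta (2 ^+ 6) ^+ 2 + 1152 * 4 ^+ 7 * B)%:E)%E.
Proof.
move=> s_gen.
pose e (k : nat) : R := if k is k'.+1
  then 1152 * 4 ^+ 7 * (theta (2 ^+ (k' + 7)) ^+ 2 / 4 ^+ (k' + 7))
  else 2 * theta (2 ^+ 6) ^+ 2.
have e0 k : 0 <= e k.
  case: k => [|k] /=; first by rewrite mulr_ge0 ?sqr_ge0.
  apply: mulr_ge0; [exact: mulr_ge0 (ler0n _ _) (exprn_ge0 _ (ler0n _ _))|].
  exact: divr_ge0 (sqr_ge0 _) (exprn_ge0 _ (ler0n _ _)).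
have energy_scale k : (\esum_(h in [set: heisZ])
    ((bump k (h * s)%g - bump k h) ^+ 2)%:E <= (e k)%:E)%E.
  case: k => [|k] /=.
    pose d (h : heisZ) : R := if h == 1%g then theta (2 ^+ 6) ^+ 2 else 0.
    have d0 h : 0 <= d h by rewrite /d; case: ifP; rewrite ?sqr_ge0.
    have dsum : (\esum_(h in [set: heisZ]) (d h)%:E <= (theta (2 ^+ 6) ^+ 2)%:E)%E.
      apply: le_trans (@esum_le_sum _ unit _ (fun=> 1%g) _ _ _ _) _.
      - by move=> [] [].
      - by move=> h; rewrite lee_fin.
      - by move=> h; rewrite /d; case: (h =P 1%g) => [->|_]; [exists tt|rewrite eqxx].
      by rewrite big_const card_unit /= addr0 lee_fin /d eqxx.
    apply: (@le_trans _ _ (\esum_(h in [set: heisZ]) ((d (h * s)%g)%:E + (d h)%:E))%E).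
      apply: le_esum => h _; rewrite -EFinD lee_fin /d.
      by case: ifP => _; case: ifP => _;
         rewrite ?subrr ?subr0 ?sub0r ?sqrrN ?expr0n ?addr0 ?add0r //=; nra.
    rewrite esumD; [|by move=> h _; rewrite lee_fin d0..].
    rewrite (esum_heisZ_mulr s (fun h => (d h)%:E)).
    by apply: le_trans (leeD dsum dsum) _; rewrite -EFinD lee_fin; lra.
  set w := theta _ / _; have X4 : 4 ^+ k != 0 :> R by rewrite expf_neq0 ?pnatr_eq0.
  have -> : 1152 * 4 ^+ 7 * (theta (2 ^+ (k + 7)) ^+ 2 / 4 ^+ (k + 7)) =
      w ^+ 2 * (1152 * (2 ^ k) ^ 2)%:R.
    have E4 : ((2 ^ k) ^ 2)%:R = 4 ^+ k :> R by rewrite -expnM mulnC expnM natrX.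
    rewrite natrM E4 /w [4 ^+ (k + 7)]exprD; set c := 4 ^+ 7.
    by field; rewrite X4 /c expf_neq0 ?pnatr_eq0.
  apply: le_trans (cutoff_energy _ s_gen (sqr_ge0 w)); last by rewrite expn_gt0.
  by apply: le_esum => h _; rewrite -mulrBr exprMn.
rewrite /energy; have -> : (\esum_(t in [set: nat * heisZ])
     ((bump t.1 (t.2 * s)%g - bump t.1 t.2) ^+ 2)%:E =
   \esum_(k in [set: nat]) \esum_(h in [set: heisZ])
     ((bump k (h * s)%g - bump k h) ^+ 2)%:E)%E.
  rewrite esum_esum; last by move=> k h _ _; rewrite lee_fin sqr_ge0.
  by congr esum; apply/seteqP; split.
apply: (@le_trans _ _ (\esum_(k in [set: nat]) (e k)%:E)%E).
  by apply: le_esum => k _.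
rewrite -nneseries_esumT; last by move=> k; rewrite lee_fin.
apply: lime_le; first by apply: is_cvg_nneseries => k _ _; rewrite lee_fin.
apply: nearW => J; rewrite sumEFin lee_fin.
apply: (@le_trans _ _ (\sum_(0 <= k < J.+1) e k)).
  by rewrite big_nat_recr //= lerDl.
rewrite big_nat_recl //= lerD2l.
rewrite -mulr_sumr ler_wpM2l ?mulr_ge0 ?exprn_ge0 ?ler0n //.
apply: le_trans (theta_B (J + 7)).
rewrite -(big_mkord xpredT (fun j => theta (2 ^+ j) ^+ 2 / 4 ^+ j)).
have shift := @big_addn R 0 +%R 0 (J + 7) 7 xpredT (fun j => theta (2 ^+ j) ^+ 2 / 4 ^+ j).
rewrite add0n addnK in shift.
rewrite [leRHS](big_cat_nat (n := 7)) ?leq_addl //= shift.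
by rewrite lerDr sumr_ge0 // => j _; rewrite divr_ge0 ?sqr_ge0 ?exprn_ge0.
Qed.

Lemma energy_lty g : (energy (heis_coord g) < +oo)%E.
Proof.
have [[s [_ sS ->]] _] := heis_word_lengthP g.
elim: s sS => [|x s IHs] sS; first by rewrite big_nil heis_coord1 energy1.
rewrite big_cons heis_coordM; apply: le_lt_trans (energyM _ _) _.
have s_lty : (energy (heis_coord (\prod_(y <- s) y)%g) < +oo)%E.
  by apply: IHs => y ys; apply: sS; rewrite inE ys orbT.
have x_lty : (energy (heis_coord x) < +oo)%E.
  have : heis_S x by apply: sS; rewrite mem_head.
  by case=> [[[->|->]|->]|->]; rewrite ?heis_coordV ?energyV ?heis_coord_a ?heis_coord_b;
     (apply: le_lt_trans (energy_gen _) (ltry _); by [left|right]).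
by rewrite !lte_add_pinfty.
Qed.

(** The support of the cutoff at scale n = 2^k has length at most 20 n, so an element
    of length more than 40 n makes it disjoint from its translate; this holds from
    length 2^(k+6) on. *)
Lemma energy_lower g : g != 1%g ->
  ((theta (word_length heis_S g)%:R ^+ 2)%:E <= energy (heis_coord g))%E.
Proof.
move=> g1; set q := heis_coord g; set d := word_length _ g.
have d0 : (0 < d)%N.
  have := heis_dW_gt0 (x := 1%g) (y := g).
  by rewrite eq_sym g1 /heis_dW /word_dist invg1 mul1g; apply.
have q1 : q != 1%g by rewrite -heis_coord1 (inj_eq (can_inj heis_coordK)).
have a0 (t : nat * heisZ) : (0%:E <= ((bump t.1 (t.2 * q)%g - bump t.1 t.2) ^+ 2)%:E)%E.
  by rewrite lee_fin sqr_ge0.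
have sqr_nd (s t : R) : 0 < s -> s <= t -> theta s ^+ 2 <= theta t ^+ 2.
  by move=> s0 st; rewrite lerXn2r ?nnegrE ?theta_nd ?theta_ge0 // (lt_le_trans s0).
have [d64|d64] := ltnP d 64.
  have bump1 : bump 0 (1 * q)%g - bump 0 1%g = - theta (2 ^+ 6).
    by rewrite mul1g /bump (negPf q1) eqxx sub0r.
  have inj1 : injective (fun _ : unit => (0%N, 1%g : heisZ)) by move=> [] [].
  have := sum_le_esum inj1 a0.
  rewrite (big_pred1 tt) => [|[]//]; rewrite bump1 sqrrN; apply: le_trans.
  rewrite lee_fin sqr_nd ?ltr0n // -natrX ler_nat; exact: ltnW.
pose i := trunc_log 2 d.
have [id di] : (2 ^ i <= d)%N /\ (d < 2 ^ i.+1)%N.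
  by split; [exact: trunc_logP|exact: trunc_log_ltn].
have i6 : (6 <= i)%N.
  rewrite -ltnS -(ltn_exp2l _ _ (isT : (1 < 2)%N)).
  exact: leq_ltn_trans d64 di.
pose k := (i - 6)%N; pose n := (2 ^ k)%N.
have n0 : (0 < n)%N by rewrite expn_gt0.
have n_lt_d : (40 * n < d)%N.
  apply: leq_trans id; rewrite -(subnK i6) expnD -/k -/n; lia.
have disj h : cutoff R n h * cutoff R n (h * q)%g = 0.
  apply/eqP; rewrite mulf_eq0 -[_ || _]negbK negb_or; apply/negP => /andP[h_in hq_in].
  have len p : cutoff R n p != 0 -> (word_length heis_S (heis_of p) <= 20 * n)%N.
    case/(cutoff_neq0 n0); elim/mkZP: p => x y z /= xn yn zn.
    have -> : (20 * n = 10 * (2 * n))%N by rewrite mulnA.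
    by apply: word_length_box; nia.
  have : (d <= 20 * n + 20 * n)%N.
    rewrite /d -[g]heis_coordK -/q -[q](mulKg h) heis_ofM heis_ofV.
    apply: leq_trans (word_lengthM _ _) _.
    by rewrite leq_add ?len // (leq_trans (word_lengthV _)) ?len.
  by lia.
have inj_oct : injective (fun j => (k.+1, @octant n j)).
  by move=> j j' E; apply: (@octant_inj n); have /= := congr1 snd E.
apply: le_trans (sum_le_esum inj_oct a0).
pose w := theta (2 ^+ (k + 7)) / 4 ^+ k.
have lower_term j : w ^+ 2 * cutoff R n (@octant n j) ^+ 2 <=
    (bump k.+1 (@octant n j * q)%g - bump k.+1 (@octant n j)) ^+ 2.
  rewrite /bump -/n -/w -mulrBr [leRHS]exprMn ler_wpM2l ?sqr_ge0 //.
  have := disj (@octant n j); set a := cutoff R n _; set b := cutoff R n _ => ab.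
  by have := sqr_ge0 b; nra.
rewrite sumEFin lee_fin; apply: le_trans (ler_sum _ (fun j _ => lower_term j)).
rewrite -mulr_sumr sum_octant //.
have X4 : 4 ^+ k != 0 :> R by rewrite expf_neq0 ?pnatr_eq0.
have -> : (n ^ 4)%:R = (4 ^+ k) ^+ 2 :> R.
  have n4 : (n ^ 4 = (4 ^ k) ^ 2)%N.
    by rewrite /n -[in RHS](expnM 2 2 k) -!expnM; congr (2 ^ _)%N; lia.
  by rewrite n4 natrX natrX.
rewrite /w -exprMn divfK //; apply: sqr_nd; first by rewrite ltr0n.
rewrite -natrX ler_nat; apply: leq_trans (ltnW di) _.
by rewrite leq_exp2l // /k; lia.
Qed.

(** The squared distance between the images of x and y is the energy of x^-1 y.  A
    bound on the energy of the generators therefore makes the map Lipschitz. *)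
Theorem exists_embedding : exists f : heisenberg -> L2 R,
  heis_lipschitz f /\
  forall x y, x != y -> theta (heis_dW x y)%:R <= L2dist (f x) (f y).
Proof.
pose u (g : heisenberg) (t : nat * heisZ) :=
  bump t.1 (t.2 * heis_coord g)%g - bump t.1 t.2.
have [|f fE] := @L2_of_family R _ _ u.
  by move=> g; exact: energy_lty.
have f_energy x y : ((L2dist (f x) (f y) ^+ 2)%:E = energy (heis_coord (x^-1 * y)%g))%E.
  rewrite fE heis_coordM heis_coordV -energyE; apply: eq_esum => t _ /=.
  by rewrite /u opprB addrA subrK.
exists f; split; last first.
  move=> x y xy; have xy1 : (x^-1 * y)%g != 1%g.
    by apply: contra xy => /eqP/(canRL (mulKg _)); rewrite invgK mulg1 => ->.
  rewrite -ler_sqr ?nnegrE ?L2dist_ge0 ?theta_ge0 ?ltr0n ?heis_dW_gt0 //.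
  by rewrite -lee_fin f_energy; exact: energy_lower.
set K := 2 * theta (2 ^+ 6) ^+ 2 + 1152 * 4 ^+ 7 * B.
have step g s : heis_S s -> L2dist (f g) (f (g * s)%g) <= Num.sqrt K.
  move=> Ss; rewrite -[leLHS]ger0_norm ?L2dist_ge0 // -sqrtr_sqr ler_wsqrtr //.
  rewrite -lee_fin f_energy mulKg.
  by case: Ss => [[[->|->]|->]|->]; rewrite ?heis_coordV ?energyV ?heis_coord_a
    ?heis_coord_b; apply: energy_gen; by [left|right].
have path s g : {in s, forall h, heis_S h} ->
    L2dist (f g) (f (g * \prod_(h <- s) h)%g) <= Num.sqrt K * (size s)%:R.
  elim: s g => [|h s IHs] g sS.
    rewrite big_nil mulg1 mulr0 -ler_sqr ?nnegrE ?L2dist_ge0 //.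
    by rewrite -lee_fin f_energy mulVg heis_coord1 energy1 expr0n.
  rewrite big_cons mulgA; apply: le_trans (L2dist_triangle _ (f (g * h)%g) _) _.
  rewrite /= -natr1 mulrDr mulr1 addrC; apply: lerD.
    by apply: IHs => k ks; apply: sS; rewrite inE ks orbT.
  by apply: step; apply: sS; rewrite mem_head.
exists (Num.sqrt K) => x y.
have [[s [s_size sS sE]] _] := heis_word_lengthP (x^-1 * y)%g.
rewrite /heis_dW /word_dist -s_size -[y in leLHS](mulVKg x) sE.
exact: path.
Qed.

End Construction.

Unset Implicit Arguments.

Theorem corollary1p5 (R : realType) (theta : R -> R)
    (theta_ge0 : forall t : R, 0 < t -> 0 <= theta t)
    (theta_nd : forall s t : R, 0 < s -> s <= t -> theta s <= theta t) :
  (exists f : heisenberg -> L2 R,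
     heis_lipschitz f /\
     forall t : R, 0 < t -> ((theta t)%:E <= compression_rate f t)%E)
  <->
  (\int[@lebesgue_measure R]_(t in `[1%R, +oo[) ((theta t / t) ^+ 2 / t)%:E
     < +oo)%E.
Proof.
split=> [[f [[L0 f_lip0] /(le_compression_rateP f theta_ge0) theta_f]]|].
  pose L := Num.max L0 0.
  have f_lip x y : L2dist (f x) (f y) <= L * (heis_dW x y)%:R.
    by apply: le_trans (f_lip0 x y) _; rewrite ler_wpM2r // le_max lexx.
  have L_ge0 : 0 <= L by rewrite le_max lexx orbT.
  have theta_sum := theta_sum_le L_ge0 f_lip theta_ge0 theta_nd theta_f.
  exact: (integral_of_dyadic_sum theta_ge0 theta_nd theta_sum).
move=> /(dyadic_sum_of_integral theta_ge0 theta_nd)[B _ theta_B].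
have [f [f_lip theta_f]] := exists_embedding theta_ge0 theta_nd theta_B.
by exists f; split=> //; exact/(le_compression_rateP f theta_ge0).
Qed.
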